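(* Let $p,d,d_1,d_2$ be positive integers and let $\boldsymbol{K}:(\mathbb{T}^{d_1,d_2}\times\mathbb{R}^d)\times(\mathbb{T}^{d_1,d_2}\times\mathbb{R}^d)\to\mathbb{R}^{p\times p}$ belong to the class $\Xi(\mathbb{T}^{d_1,d_2},\mathbb{R}^d)$, with coefficient functions $\Upsilon_{\boldsymbol{k},j,j'}$. Then: (i) For every fixed $\mathbf{u},\mathbf{u}'\in\mathbb{R}^d$ and all $\ell,m\in\{1,\dots,p\}$, $$\sum_{\boldsymbol{k}\in\mathbb{N}_0^2}\sum_{j=1}^{\kappa_{d_1,k_1}}\sum_{j'=1}^{\kappa_{d_2,k_2}}\Big|\Upsilon^{(\ell,m)}_{\boldsymbol{k},j,j'}(\mathbf{u},\mathbf{u}')\Big|^2<\infty,$$ where $\Upsilon^{(\ell,m)}_{\boldsymbol{k},j,j'}$ denotes the $(\ell,m)$-element of $\Upsilon_{\boldsymbol{k},j,j'}$. Additionally, $$\Upsilon_{\boldsymbol{k},j,j'}(\mathbf{u},\mathbf{u}')=\int_{\mathbb{T}^{d_1,d_2}}\int_{\mathbb{T}^{d_1,d_2}}\boldsymbol{K}\big((\mathbf{x},\mathbf{u}),(\mathbf{x}',\mathbf{u}')\big)\,\overline{Y_{k_1,j}(x_1)}\,Y_{k_1,j}(x_1')\,\overline{Y_{k_2,j'}(x_2)}\,Y_{k_2,j'}(x_2')\,\mathrm{d}\lambda_{d_1,d_2}(\mathbf{x})\,\mathrm{d}\lambda_{d_1,d_2}(\mathbf{x}'),$$ where $\mathrm{d}\lambda_{d_1,d_2}=\mathrm{d}\sigma_{d_1}\otimes\mathrm{d}\sigma_{d_2}$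 and $\sigma_{d_i}$ is the Lebesgue (surface) measure on $\mathbb{S}^{d_i}$, $i=1,2$. (ii) $\boldsymbol{K}$ is positive definite if and only if $\{\Upsilon_{\boldsymbol{k},j,j'}\}$ is a sequence of positive definite functions on $\mathbb{R}^d\times\mathbb{R}^d$.
   Context: $\mathbb{S}^{n}$ is the unit sphere of $\mathbb{R}^{n+1}$; $\mathbb{T}^{d_1,d_2}=\mathbb{S}^{d_1}\times\mathbb{S}^{d_2}$, with points $\mathbf{x}=(x_1,x_2)$. Spherical harmonics: for each $n\in\{d_1,d_2\}$ and $k\in\mathbb{N}_0$, $\{Y_{k,j}: j=1,\dots,\kappa_{n,k}\}$ is an orthonormal basis (in $L^2(\mathbb{S}^n,\sigma_n)$) of the eigenspace $\mathcal{H}_k$ of the Laplace–Beltrami operator on $\mathbb{S}^n$ with eigenvalue $-k(k+n-1)$, and $\kappa_{n,k}=\dim\mathcal{H}_k=(2k+n-1)\frac{(k+n-2)!}{k!(n-1)!}$ (equal to $1$ if $k=0$, $n=1$). $Y_{k_1,j}$ refers to the basis on $\mathbb{S}^{d_1}$ and $Y_{k_2,j'}$ to the basis on $\mathbb{S}^{d_2}$. The class $\Xi(\mathbb{T}^{d_1,d_2},\mathbb{R}^d)$ consists of the mappings $\boldsymbol{K}:(\mathbb{T}^{d_1,d_2}\times\mathbb{R}^d)\times(\mathbb{T}^{d_1,d_2}\times\mathbb{R}^d)\to\mathbb{R}^{p\times p}$ such that $$\boldsymbol{K}\big((\mathbf{x},\mathbf{u}),(\mathbf{x}',\mathbf{u}')\big)=\sum_{\boldsymbol{k}=(k_1,k_2)\in\mathbb{N}_0^2}\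 \sum_{j=1}^{\kappa_{d_1,k_1}}\ \sum_{j'=1}^{\kappa_{d_2,k_2}}\Upsilon_{\boldsymbol{k},j,j'}(\mathbf{u},\mathbf{u}')\,Y_{k_1,j}(x_1)\overline{Y_{k_1,j}(x_1')}\,Y_{k_2,j'}(x_2)\overline{Y_{k_2,j'}(x_2')}$$ for some $p\times p$ matrix valued functions $\Upsilon_{\boldsymbol{k},j,j'}$ on $\mathbb{R}^d\times\mathbb{R}^d$ (with complex entries allowed), where for each fixed $\mathbf{u},\mathbf{u}'$ the expansion (as the limit of the partial sums over $0\le k_1\le N$, $0\le k_2\le N'$ as $N,N'\to\infty$) converges uniformly in $(\mathbf{x},\mathbf{x}')\in\mathbb{T}^{d_1,d_2}\times\mathbb{T}^{d_1,d_2}$. Positive definiteness: for a nonempty set $X$, a matrix valued function $\boldsymbol{G}:X\times X\to\mathbb{C}^{p\times p}$ with $\boldsymbol{G}(x,y)=\overline{\boldsymbol{G}(y,x)}^\top$ is positive definite if $\sum_{k,h=1}^N\boldsymbol{a}_k^\top\boldsymbol{G}(x_k,x_h)\overline{\boldsymbol{a}_h}\ge0$ for all $N$, all $x_1,\dots,x_N\in X$ and all $\boldsymbol{a}_1,\dots,\boldsymbol{a}_N\in\mathbb{C}^p$ (for real valued $\boldsymbol{G}$ it is equivalent to take $\boldsymbol{a}_k\in\mathbb{R}^p$). *)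

(* Defs.v *)
From HB Require Import structures.
From mathcomp Require Import all_boot all_order all_algebra.
From mathcomp Require Import complex.
From mathcomp Require Import all_classical all_reals all_analysis.
From mathcomp Require Import measurable_realfun.

Set Implicit Arguments.
Unset Strict Implicit.
Unset Printing Implicit Defensive.

Import Order.TTheory GRing.Theory Num.Theory.
Import numFieldNormedType.Exports.

Local Open Scope classical_set_scope.
Local Open Scope ring_scope.

Section lebesgue_tuple.
Context {R : realType}.
Local Notation mR := (measurableTypeR R).

Definition tuple_cons n (x : mR * n.-tuple mR) : n.+1.-tuple mR :=
  [tuple of x.1 :: x.2].

Definition tuple_uncons n (t : n.+1.-tuple mR) : mR * n.-tuple mR :=
  (thead t, [tuple of behead t]).

Lemma tuple_unconsK n : cancel (@tuple_uncons n) (@tuple_cons n).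
Proof. by move=> t; rewrite /tuple_cons/= [RHS]tuple_eta; apply/val_inj. Qed.

Lemma tuple_consK n : cancel (@tuple_cons n) (@tuple_uncons n).
Proof.
move=> [x t]; rewrite /tuple_uncons/=; congr (_, _); exact/val_inj.
Qed.

Lemma measurable_tuple_cons n : measurable_fun setT (@tuple_cons n).
Proof. exact: measurable_cons. Qed.

Lemma measurable_tuple_uncons n : measurable_fun setT (@tuple_uncons n).
Proof.
apply: measurable_fun_pair; last exact: measurable_behead.
exact: measurable_tnth.
Qed.

Section cons_measure.
Variables (n : nat) (mu : {sigma_finite_measure set (n.-tuple mR) -> \bar R}).

(* The product measure [dx * mu], transported to [R^(n+1)] *)
Definition cons_measure : set (n.+1.-tuple mR) -> \bar R :=
  pushforward (lebesgue_measure \x mu)%E (@tuple_cons n).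

HB.instance Definition _ := Measure.copy cons_measure
  (measure_function_pushforward__canonical__measure_function_Measure
     (lebesgue_measure \x mu)%E (@measurable_tuple_cons n)).

Lemma cons_measureE (A : set mR) (B : set (n.-tuple mR)) :
  measurable A -> measurable B ->
  cons_measure (@tuple_uncons n @^-1` (A `*` B)) =
  (lebesgue_measure A * mu B)%E.
Proof.
move=> mA mB; rewrite /cons_measure /pushforward -comp_preimage.
rewrite (_ : _ \o _ = id); last exact/funext/tuple_consK.
by rewrite preimage_id product_measure1E.
Qed.

Let cons_measure_sigma_finite : sigma_finite setT cons_measure.
Proof.
have /sigma_finiteP[F [TF ndF Foo]] :=
  sigma_finiteT [the {sigma_finite_measure set mR -> \bar R} of lebesgue_measure].
have /sigma_finiteP[G [TG ndG Goo]] := sigma_finiteT mu.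
exists (fun k => @tuple_uncons n @^-1` (F k `*` G k)).
  rewrite predeqE => t; split => // _.
  have [k _ Fk] : (\bigcup_k F k) (thead t) by rewrite -TF.
  have [l _ Gl] : (\bigcup_k G k) [tuple of behead t] by rewrite -TG.
  exists (maxn k l) => //; split => /=.
    by move: Fk; exact/subsetPset/ndF/leq_maxl.
  by move: Gl; exact/subsetPset/ndG/leq_maxr.
move=> k; have [mF Fk] := Foo k; have [mG Gk] := Goo k; split.
  rewrite -[X in measurable X]setTI; apply: measurable_tuple_uncons => //.
  exact: measurableX.
by rewrite cons_measureE// lte_mul_pinfty// ge0_fin_numE.
Qed.

HB.instance Definition _ := @Measure_isSigmaFinite.Build _ _ _
  cons_measure cons_measure_sigma_finite.

End cons_measure.

Fixpoint lebesgue_tuple n : {sigma_finite_measure set (n.-tuple mR) -> \bar R} :=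
  match n with
  | 0 => \d_ [tuple]
  | m.+1 => cons_measure (lebesgue_tuple m)
  end.

End lebesgue_tuple.

Definition enorm (R : realType) n (y : 'rV[R]_n) : R :=
  Num.sqrt (\sum_i y 0 i ^+ 2).

Record sphere (R : realType) (n : nat) :=
  Sphere { sphere_val :> 'rV[R]_n.+1 ; _ : enorm sphere_val == 1 }.

HB.instance Definition _ (R : realType) n := [isSub for @sphere_val R n].
HB.instance Definition _ (R : realType) n := [Choice of sphere R n by <:].

Section sphere.
Context {R : realType}.
Variable n : nat.
Local Notation mR := (measurableTypeR R).

Lemma enorm_delta : enorm (delta_mx 0 0 : 'rV[R]_n.+1) == 1.
Proof.
rewrite /enorm (bigD1 ord0)//= big1 ?mxE ?eqxx ?expr1n ?addr0 ?sqrtr1//.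
by move=> i i0; rewrite mxE (negPf i0) expr0n.
Qed.

HB.instance Definition _ := isPointed.Build (sphere R n) (Sphere enorm_delta).

(* The Borel sigma-algebra of the sphere, generated by the coordinates *)
Let coor (i : 'I_n.+1) (x : sphere R n) : mR := x 0 i.

Let sphere_set0 : g_sigma_preimage coor set0.
Proof. exact: sigma_algebra0. Qed.

Let sphere_setC A : g_sigma_preimage coor A -> g_sigma_preimage coor (~` A).
Proof. exact: sigma_algebraC. Qed.

Let sphere_bigcup (F : (set (sphere R n))^nat) :
  (forall i, g_sigma_preimage coor (F i)) ->
  g_sigma_preimage coor (\bigcup_i (F i)).
Proof. exact: sigma_algebra_bigcup. Qed.

HB.instance Definition _ := @isMeasurable.Build default_measure_display
  (sphere R n) (g_sigma_preimage coor) sphere_set0 sphere_setC sphere_bigcup.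

Lemma measurable_fun_sphere d (T : measurableType d) (f : T -> sphere R n) :
  (forall i, measurable_fun setT (fun t => f t 0 i : mR)) ->
  measurable_fun setT f.
Proof.
move=> mf; apply: (@measurability _ _ _ _ _ _ (\big[setU/set0]_(i < n.+1)
  preimage_set_system setT (coor i) measurable)) => //.
move=> _ [A + <-]; rewrite -bigcup_seq/= => -[i _ [B mB <-]].
rewrite !setTI -[X in measurable X]setTI -comp_preimage.
exact: (mf i measurableT B mB).
Qed.

(* [x / |x|]; at [x = 0] the value is an arbitrary point of the sphere *)
Definition radial (y : 'rV[R]_n.+1) : sphere R n :=
  insubd (point : sphere R n) ((enorm y)^-1 *: y).

Lemma enormZ (a : R) (y : 'rV[R]_n.+1) : enorm (a *: y) = `|a| * enorm y.
Proof.
rewrite /enorm (eq_bigr (fun i => a ^+ 2 * y 0 i ^+ 2)).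
  by rewrite -mulr_sumr sqrtrM ?sqr_ge0// sqrtr_sqr.
by move=> i _; rewrite mxE exprMn.
Qed.

Lemma radialE (y : 'rV[R]_n.+1) : radial y =
  (if enorm y == 0 then val (point : sphere R n) else (enorm y)^-1 *: y)
  :> 'rV[R]_n.+1.
Proof.
rewrite /radial val_insubd enormZ normfV ger0_norm ?sqrtr_ge0//.
have [->|y0] := eqVneq (enorm y) 0; first by rewrite mulr0 eq_sym oner_eq0.
by rewrite mulVf// eqxx.
Qed.

Definition row_of_tuple (t : n.+1.-tuple mR) : 'rV[R]_n.+1 :=
  \row_i tnth t i.

Lemma measurable_enorm :
  measurable_fun setT (fun t => enorm (row_of_tuple t) : R).
Proof.
rewrite /enorm (_ : (fun _ => _) = (fun t : n.+1.-tuple mR =>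
    (\sum_i (tnth t i : R) ^+ 2) `^ 2^-1)).
  apply: (measurableT_comp (measurable_powR _)).
  apply: measurable_sum => i; apply: measurable_funX.
  exact: measurable_tnth.
apply/funext => t; rewrite powR12_sqrt; last first.
  by apply: sumr_ge0 => i _; exact: sqr_ge0.
by congr Num.sqrt; apply: eq_bigr => i _; rewrite mxE.
Qed.

Lemma measurable_radial : measurable_fun setT (radial \o row_of_tuple).
Proof.
apply: measurable_fun_sphere => i.
rewrite (_ : (fun _ => _) = (fun t => if enorm (row_of_tuple t) == 0
   then val (point : sphere R n) 0 i
   else enorm (row_of_tuple t) `^ (-1) * (tnth t i : R))); last first.
  apply/funext => t/=; rewrite radialE; case: ifP => // _.
  by rewrite !mxE powR_inv1// sqrtr_ge0.
apply: measurable_fun_ifT => //.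
  apply: measurable_fun_eqr; first exact: measurable_enorm.
  exact: measurable_cst.
apply: measurable_funM; last exact: measurable_tnth.
exact: (measurableT_comp (measurable_powR _) measurable_enorm).
Qed.

Definition punctured_ball : set (n.+1.-tuple mR) :=
  [set t | 0 < enorm (row_of_tuple t) <= 1].

Lemma measurable_punctured_ball : measurable punctured_ball.
Proof.
rewrite (_ : punctured_ball =
    (fun t => enorm (row_of_tuple t) : R) @^-1` [set` `]0, 1]]).
  by rewrite -[X in measurable X]setTI; exact: measurable_enorm.
by apply/seteqP; split => t; rewrite /= in_itv.
Qed.

Lemma lebesgue_tuple_cube k : exists C : set (k.-tuple mR),
  [/\ measurable C, (lebesgue_tuple k C < +oo)%E &
   forall t : k.-tuple mR, (forall i, `|tnth t i : R| <= 1) -> C t].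
Proof.
elim: k => [|k [C [mC Coo CP]]].
  exists setT; split=> //=; first by rewrite diracT ltry.
pose I : set mR := [set x : R | x \in `[-1, 1]].
have mI : measurable I.
  by rewrite (_ : I = `[-1 : R, 1 : R]%classic)//; apply: measurable_itv.
exists (@tuple_uncons _ k @^-1` (I `*` C)); split.
- rewrite -[X in measurable X]setTI; apply: measurable_tuple_uncons => //.
  exact: measurableX.
- rewrite /= cons_measureE//; apply: lte_mul_pinfty => //.
  rewrite ge0_fin_numE// (_ : I = `[-1 : R, 1 : R]%classic)//.
  by rewrite lebesgue_measure_itv/=; case: ifP => // _; rewrite -EFinB ltry.
- move=> t tP; split => /=.
    by rewrite /I/= in_itv/= -ler_norml; exact: tP.
  apply: CP => i; apply: le_trans (tP (lift ord0 i)).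
  by rewrite [in leRHS](tuple_eta t) tnthS.
Qed.

Lemma lebesgue_punctured_ball :
  (lebesgue_tuple n.+1 punctured_ball < +oo)%E.
Proof.
have [C [mC Coo CP]] := lebesgue_tuple_cube n.+1.
apply: le_lt_trans Coo; apply: le_measure; rewrite ?inE//.
  exact: measurable_punctured_ball.
move=> t /andP[_ t1]; apply: CP => i.
apply: le_trans t1; rewrite -sqrtr_sqr; apply: ler_wsqrtr.
rewrite (bigD1 i)//= mxE lerDl; apply: sumr_ge0 => j _; exact: sqr_ge0.
Qed.

(* Surface measure as cone measure: if the area of [A] is [s], then in polar
   coordinates the volume of [{r x | x \in A, 0 < r <= 1}] is
   [s * \int_0^1 r^n dr = s / (n + 1)] *)
Definition surface_measure (A : set (sphere R n)) : \bar R :=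
  ((n.+1%:R)%:E * lebesgue_tuple n.+1
     ((radial \o row_of_tuple) @^-1` A `&` punctured_ball))%E.

HB.instance Definition _ := Measure.copy surface_measure
  (mscale (n.+1%:R)%:nng
    (measure_function_pushforward__canonical__measure_function_Measure
      (mrestr (lebesgue_tuple n.+1) measurable_punctured_ball)
      measurable_radial)).

Let surface_measure_fin : fin_num_fun surface_measure.
Proof.
move=> A mA; rewrite ge0_fin_numE ?measure_ge0//.
apply: (@le_lt_trans _ _ (surface_measure setT)).
  by apply: le_measure; rewrite ?inE.
rewrite /surface_measure preimage_setT setTI lte_mul_pinfty//.
  exact: lebesgue_punctured_ball.
Qed.

HB.instance Definition _ := @Measure_isFinite.Build _ _ _
  surface_measure surface_measure_fin.

End sphere.
Arguments radial {R n} y.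
Arguments surface_measure {R} n _.

Notation torus R d1 d2 := (sphere R d1 * sphere R d2)%type.

Section torus_measure.
Context {R : realType}.
Variables d1 d2 : nat.

Definition torus_measure : set (torus R d1 d2) -> \bar R :=
  (surface_measure d1 \x surface_measure d2)%E.

HB.instance Definition _ := Measure.on torus_measure.

Let torus_measure_fin : fin_num_fun torus_measure.
Proof.
move=> A mA; rewrite ge0_fin_numE ?measure_ge0//.
apply: (@le_lt_trans _ _ (torus_measure setT)).
  by apply: le_measure; rewrite ?inE.
rewrite /torus_measure -setXTT product_measure1E// lte_mul_pinfty//.
  exact: fin_num_measure.
by rewrite -ge0_fin_numE// fin_num_measure.
Qed.

HB.instance Definition _ := @Measure_isFinite.Build _ _ _
  torus_measure torus_measure_fin.

End torus_measure.
Arguments torus_measure {R} d1 d2 _.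

Section complex_integral.
Context {R : realType} d (T : measurableType d).

Definition cintegrable (mu : set T -> \bar R) (f : T -> R[i]) : Prop :=
  mu.-integrable setT (fun x => (complex.Re (f x))%:E) /\
  mu.-integrable setT (fun x => (complex.Im (f x))%:E).

Definition cintegral (mu : {measure set T -> \bar R}) (f : T -> R[i]) : R[i] :=
  Complex (\int[mu]_x complex.Re (f x)) (\int[mu]_x complex.Im (f x)).

Definition mxintegral (mu : {measure set T -> \bar R}) p
    (F : T -> 'M[R[i]]_p) : 'M[R[i]]_p :=
  \matrix_(l, m) cintegral mu (fun x => F x l m).

End complex_integral.

Section spherical_harmonics.
Context {R : realType}.
Variable n : nat.

Definition homog0 (f : sphere R n -> R) (y : 'rV[R]_n.+1) : R := f (radial y).

Definition partial (i : 'I_n.+1) (F : 'rV[R]_n.+1 -> R) : 'rV[R]_n.+1 -> R :=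
  'D_(delta_mx 0 i) F.

Definition has_partial (i : 'I_n.+1) (F : 'rV[R]_n.+1 -> R) (y : 'rV[R]_n.+1) :=
  derivable F y (delta_mx 0 i).

(* [f] is of class C^2 on the sphere: its extension to [R^(n+1) \ {0}] that is
   constant along rays is of class C^2 there *)
Definition sphere_C2 (f : sphere R n -> R) : Prop :=
  forall y : 'rV[R]_n.+1, y != 0 ->
    {for y, continuous (homog0 f)} /\
    forall i,
      [/\ has_partial i (homog0 f) y,
          {for y, continuous (partial i (homog0 f))} &
          forall j, has_partial j (partial i (homog0 f)) y /\
            {for y, continuous (partial j (partial i (homog0 f)))}].

(* The Laplace-Beltrami operator of the unit sphere is the Euclidean Laplacian
   of the extension that is constant along rays *)
Definition laplace_beltrami (f : sphere R n -> R) (x : sphere R n) : R :=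
  \sum_i partial i (partial i (homog0 f)) x.

Definition claplace_beltrami (f : sphere R n -> R[i]) (x : sphere R n) : R[i] :=
  Complex (laplace_beltrami (@complex.Re R \o f) x)
          (laplace_beltrami (@complex.Im R \o f) x).

(* Truncated subtraction is harmless here and in [kappa], as [n >= 1] *)
Definition harmonic_space (k : nat) (f : sphere R n -> R[i]) : Prop :=
  [/\ sphere_C2 (@complex.Re R \o f), sphere_C2 (@complex.Im R \o f) &
      forall x, claplace_beltrami f x = - (k * (k + n - 1))%N%:R * f x].

End spherical_harmonics.

(* At [k = 0], [n = 1] the general formula would give [0], as [(-1)!] is not
   meaningful; the value is [1] by convention *)
Definition kappa (n k : nat) : nat :=
  if (k == 0%N) && (n == 1%N) then 1%N
  else (((2 * k + n - 1) * (k + n - 2)`!) %/ (k`! * (n - 1)`!))%N.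

Definition harmonic_orthonormal_basis (R : realType) n k
    (Y : 'I_(kappa n k) -> sphere R n -> R[i]) : Prop :=
  [/\ forall j, harmonic_space k (Y j),
      forall i j, cintegral (surface_measure n)
        (fun x => Y i x * conjc (Y j x)) = (i == j)%:R &
      forall f, harmonic_space k f ->
        exists c : 'I_(kappa n k) -> R[i], forall x, f x = \sum_j c j * Y j x].

Definition positive_definite (R : realType) (X : Type) p
    (G : X -> X -> 'M[R[i]]_p) : Prop :=
  (forall x y, G x y = (map_mx (@conjc R) (G y x))^T) /\
  forall (N : nat) (x : 'I_N -> X) (a : 'I_N -> 'cV[R[i]]_p),
    0 <= \sum_(k < N) \sum_(h < N)
      ((a k)^T *m G (x k) (x h) *m map_mx (@conjc R) (a h)) 0 0.

Section class_Xi.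
Context {R : realType}.
Variables (p d d1 d2 : nat).
Variable Y : forall n k, 'I_(kappa n k) -> sphere R n -> R[i].

Definition Ymul k1 k2 (j : 'I_(kappa d1 k1)) (j' : 'I_(kappa d2 k2))
    (x x' : torus R d1 d2) : R[i] :=
  Y j x.1 * conjc (Y j x'.1) * (Y j' x.2 * conjc (Y j' x'.2)).

Variable K : torus R d1 d2 * 'rV[R]_d -> torus R d1 d2 * 'rV[R]_d -> 'M[R]_p.
Variable Upsilon : forall k1 k2, 'I_(kappa d1 k1) -> 'I_(kappa d2 k2) ->
  'rV[R]_d -> 'rV[R]_d -> 'M[R[i]]_p.

Definition Xi_partial_sum (N N' : nat) (x x' : torus R d1 d2)
    (u u' : 'rV[R]_d) : 'M[R[i]]_p :=
  \sum_(k1 < N.+1) \sum_(k2 < N'.+1)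
    \sum_(j < kappa d1 k1) \sum_(j' < kappa d2 k2)
      Ymul j j' x x' *: Upsilon j j' u u'.

(* For fixed [u, u'], entrywise uniform convergence in [(x, x')] of the
   rectangular partial sums *)
Definition Xi_expansion : Prop :=
  forall (u u' : 'rV[R]_d) (e : R), 0 < e ->
    exists M : nat, forall N N' : nat, (M <= N)%N -> (M <= N')%N ->
      forall (x x' : torus R d1 d2) (l m : 'I_p),
        ComplexField.Normc.normc (Xi_partial_sum N N' x x' u u' l m
          - real_complex R (K (x, u) (x', u') l m)) < e.

End class_Xi.

(* Main.v *)
(** Spherical harmonics of different degrees are orthogonal: let F, G be the
    extensions, constant along rays, of eigenfunctions f, g with eigenvalues
    -lam <> -nu.  By Euler's identity, sum_i y_i d_i F = 0, so for every radial
    factor psi(|y|^2) the divergence of psi (F grad G - G grad F) is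
    (lam - nu) |y|^-2 psi F G.  If psi is C^1 with compact support in (0, oo),
    Fubini and the one-dimensional fundamental theorem of calculus show that its
    integral vanishes; letting |y|^-2 psi tend to the indicator of the punctured
    unit ball, where the surface measure is defined, gives the orthogonality of
    f and g.  The products of harmonics are therefore orthonormal on the torus,
    and integrating the uniformly convergent expansion against them yields the
    coefficient formula, while integrating |partial sum|^2 yields the
    summability.

    If K is positive definite, a quadratic form of a coefficient is the double
    integral of a positive definite kernel that is a uniform limit of separable
    ones.  Replacing points by representatives of the cells of a fine finite
    measurable partition turns it, up to a small error, into a finite quadratic
    form of K, hence it is nonnegative.  Hermitian symmetry of the coefficients
    follows from uniqueness, since the conjugate transposed coefficients expand
    the same K.  Conversely, partial sums with positive definite coefficients are
    positive definite, and so is their limit. *)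

Require Import Defs.
From mathcomp Require Import all_boot all_order all_algebra.
From mathcomp Require Import complex.
From mathcomp Require Import all_classical all_reals all_analysis.
From mathcomp Require Import measurable_realfun.
From mathcomp Require Import ring lra zify.

Set Implicit Arguments.
Unset Strict Implicit.
Unset Printing Implicit Defensive.

Import Order.TTheory GRing.Theory Num.Theory.
Import numFieldNormedType.Exports.

Local Open Scope classical_set_scope.
Local Open Scope ring_scope.

Local Notation normc := ComplexField.Normc.normc.

(** * The modulus of complex numbers *)

Section normc_theory.
Context {R : realType}.
Implicit Types z w : R[i].

Lemma normc_ge0 z : 0 <= normc z.
Proof. by case: z => a b; exact: sqrtr_ge0. Qed.

Lemma normc_conj z : normc (conjc z) = normc z.
Proof. by case: z => a b /=; rewrite sqrrN. Qed.

Lemma ler_Re_normc z : `|complex.Re z| <= normc z.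
Proof. by case: z => a b /=; rewrite -sqrtr_sqr ler_wsqrtr// lerDl sqr_ge0. Qed.

Lemma ler_Im_normc z : `|complex.Im z| <= normc z.
Proof. by case: z => a b /=; rewrite -sqrtr_sqr ler_wsqrtr// lerDr sqr_ge0. Qed.

Lemma normc_le_ReIm z : normc z <= `|complex.Re z| + `|complex.Im z|.
Proof.
case: z => a b /=; rewrite -[leRHS]ger0_norm ?addr_ge0// -sqrtr_sqr.
by rewrite ler_wsqrtr// sqrrD !real_normK ?num_real// lerD2r lerDl mulrn_wge0// mulr_ge0.
Qed.

Lemma normc_sum (I : Type) (r : seq I) (F : I -> R[i]) :
  normc (\sum_(i <- r) F i) <= \sum_(i <- r) normc (F i).
Proof.
elim/big_rec2: _ => [|i x y _ h]; first by rewrite ComplexField.Normc.normc0.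
by apply: le_trans (le_normcD _ _) _; rewrite lerD2l.
Qed.

Lemma mul_conjc_normc z : z * conjc z = real_complex R (normc z ^+ 2).
Proof.
case: z => a b; rewrite /= sqr_sqrtr ?addr_ge0 ?sqr_ge0//.
by apply/eqP; rewrite eq_complex /=; apply/andP; split; apply/eqP; ring.
Qed.

Lemma normc_real (x : R) : normc (real_complex R x) = `|x|.
Proof. by rewrite /= expr0n addr0 sqrtr_sqr. Qed.

Lemma normc_small_eq z w : (forall e, 0 < e -> normc (z - w) <= e) -> z = w.
Proof.
move=> h; apply/eqP; rewrite -subr_eq0; apply/eqP/ComplexField.Normc.eq0_normc.
by apply/eqP; rewrite eq_le normc_ge0 andbT; apply/ler_addgt0Pl => e /h; rewrite addr0.
Qed.

(** Closedness of the nonnegative half-line: in [R[i]], [0 <= z] says that the imaginary part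
    vanishes and the real part is nonnegative, and both survive approximation. The factor [C] spares
    later arguments a rescaling of [e]. *)
Lemma normc_ge0_approx z (C : R) : 0 <= C ->
  (forall e, 0 < e -> exists2 w : R[i], 0 <= w & normc (z - w) <= C * e) -> 0 <= z.
Proof.
move=> C0 h.
have C1 : 0 < C + 1 by rewrite ltr_wpDl.
have hh e : 0 < e -> exists2 w : R[i], 0 <= w & normc (z - w) <= e.
  move=> e0; have [w w0 zw] := h (e / (C + 1)) (divr_gt0 e0 C1).
  exists w => //; apply: le_trans zw _; rewrite mulrCA ler_piMr ?(ltW e0)//.
  by rewrite ler_pdivrMr// mul1r lerDl.
rewrite lecE; apply/andP; split => /=.
  rewrite -normr_eq0 eq_le normr_ge0 andbT; apply/ler_addgt0Pl => e /hh[[a b]].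
  rewrite lecE/= => /andP[/eqP-> _] le; rewrite addr0.
  apply: le_trans le; apply: le_trans (ler_Im_normc _).
  by case: z {h hh} => c d /=; rewrite subr0.
apply/ler_addgt0Pl => e /hh[[a b]].
rewrite lecE/= => /andP[/eqP-> a0] le.
have := ler_Re_normc (z - Complex a 0); case: z {h hh} le => c d /= le lea.
have := le_trans lea le; rewrite ler_norml => /andP[+ _].
by rewrite lerBrDr => h; rewrite -lerBlDl sub0r (le_trans _ h)// lerDl.
Qed.

End normc_theory.

#[local] Arguments ComplexField.Normc.normc : simpl never.

(** * Bounded measurable complex functions *)

Section bounded_measurable.
Context {R : realType} d (T : measurableType d).
Implicit Types f g : T -> R[i].

(** These functions are integrable for every finite measure and, unlike integrable functions in
    general, closed under products. The complex integrands below are kept in this class. *)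
Definition bounded_measurable f : Prop :=
  [/\ measurable_fun setT (fun x => complex.Re (f x)),
      measurable_fun setT (fun x => complex.Im (f x)) &
      exists B, forall x, normc (f x) <= B].

Lemma bounded_measurable_cst (c : R[i]) : bounded_measurable (fun=> c).
Proof. by split; [exact: measurable_cst|exact: measurable_cst|exists (normc c)]. Qed.

Lemma bounded_measurableD f g : bounded_measurable f -> bounded_measurable g ->
  bounded_measurable (fun x => f x + g x).
Proof.
move=> [rf mf [B fB]] [rg mg [C gC]]; split.
- rewrite (_ : (fun _ => _) = (fun x => complex.Re (f x) + complex.Re (g x))).
    exact: measurable_funD.
  by apply/funext => x; case: (f x) (g x) => ? ? [].
- rewrite (_ : (fun _ => _) = (fun x => complex.Im (f x) + complex.Im (g x))).
    exact: measurable_funD.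
  by apply/funext => x; case: (f x) (g x) => ? ? [].
- by exists (B + C) => x; apply: le_trans (le_normcD _ _) _; exact: lerD.
Qed.

Lemma bounded_measurableM f g : bounded_measurable f -> bounded_measurable g ->
  bounded_measurable (fun x => f x * g x).
Proof.
move=> [rf mf [B fB]] [rg mg [C gC]]; split.
- rewrite (_ : (fun _ => _) = (fun x => complex.Re (f x) * complex.Re (g x)
     - complex.Im (f x) * complex.Im (g x))).
    by apply: measurable_funB; exact: measurable_funM.
  by apply/funext => x; case: (f x) (g x) => ? ? [].
- rewrite (_ : (fun _ => _) = (fun x => complex.Re (f x) * complex.Im (g x)
     + complex.Im (f x) * complex.Re (g x))).
    by apply: measurable_funD; exact: measurable_funM.
  by apply/funext => x; case: (f x) (g x) => ? ? [].
- exists (B * C) => x; rewrite ComplexField.Normc.normcM.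
  by apply: ler_pM => //; exact: normc_ge0.
Qed.

Lemma bounded_measurable_conj f : bounded_measurable f ->
  bounded_measurable (fun x => conjc (f x)).
Proof.
move=> [rf mf [B fB]]; split.
- rewrite (_ : (fun _ => _) = (fun x => complex.Re (f x)))//.
  by apply/funext => x; case: (f x).
- rewrite (_ : (fun _ => _) = (fun x => - complex.Im (f x))).
    exact: measurable_funN.
  by apply/funext => x; case: (f x).
- by exists B => x; rewrite normc_conj.
Qed.

Lemma bounded_measurable_sum (I : Type) (r : seq I) (F : I -> T -> R[i]) :
  (forall i, bounded_measurable (F i)) ->
  bounded_measurable (fun x => \sum_(i <- r) F i x).
Proof.
move=> mF; elim: r => [|i r ih].
  by under eq_fun do rewrite big_nil; exact: bounded_measurable_cst.
by under eq_fun do rewrite big_cons; exact: bounded_measurableD.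
Qed.

(** Approximants with error [1 / (n + 1)] converge pointwise, which gives measurability; a single
    approximant at distance 1 gives the bound. *)
Lemma bounded_measurable_unif f :
  (forall e : R, 0 < e -> exists2 g, bounded_measurable g &
     forall x, normc (g x - f x) <= e) -> bounded_measurable f.
Proof.
move=> h.
have /choice[g gP] : forall n : nat, exists g : T -> R[i], bounded_measurable g /\
    forall x, normc (g x - f x) <= n.+1%:R^-1.
  by move=> n; have [g ? ?] := h n.+1%:R^-1 (ltac:(by rewrite invr_gt0)); exists g.
(* [F] stands for the real or the imaginary part, both 1-Lipschitz. *)
have cvgg (F : R[i] -> R) : (forall z w, `|F z - F w| <= normc (z - w)) ->
    forall x, F (g n x) @[n --> \oo] --> F (f x).
  move=> FP x; apply/cvgrPdist_le => e e0; near=> n.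
  rewrite distrC; apply: le_trans (FP _ _) _.
  apply: le_trans ((gP n).2 x) _; apply: ltW.
  by near: n; exact: (near_infty_natSinv_lt (PosNum e0)).
split.
- apply: (@measurable_fun_cvg _ _ _ _ (fun n x => complex.Re (g n x))).
  + by move=> n; case: (gP n) => -[].
  + move=> x _; apply: cvgg => z w; rewrite -raddfB; exact: ler_Re_normc.
- apply: (@measurable_fun_cvg _ _ _ _ (fun n x => complex.Im (g n x))).
  + by move=> n; case: (gP n) => -[].
  + move=> x _; apply: cvgg => z w; rewrite -raddfB; exact: ler_Im_normc.
- have [g1 [_ _ [B gB]] gf] := h 1 ltr01.
  exists (B + 1) => x; rewrite -[f x](subKr (g1 x)).
  by apply: le_trans (le_normcD _ _) _; rewrite normcN; apply: lerD.
Unshelve. all: by end_near. Qed.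

End bounded_measurable.

Lemma bounded_measurable_comp (R : realType) d d' (T : measurableType d)
    (U : measurableType d') (f : U -> R[i]) (h : T -> U) :
  measurable_fun setT h -> bounded_measurable f ->
  bounded_measurable (fun x => f (h x)).
Proof.
move=> mh [rf mf [B fB]]; split.
- exact: (measurableT_comp rf mh).
- exact: (measurableT_comp mf mh).
- by exists B.
Qed.

(** * Complex integrals *)

Section cintegral_theory.
Context {R : realType} d (T : measurableType d).
Variable mu : {finite_measure set T -> \bar R}.
Implicit Types f g : T -> R[i].

Let muTy : (mu setT < +oo)%E.
Proof. by rewrite fin_num_fun_lty//; exact: fin_num_measure. Qed.

Lemma bounded_measurable_integrable (f : T -> R) (B : R) :
  measurable_fun setT f -> (forall x, `|f x| <= B) ->
  mu.-integrable setT (EFin \o f).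
Proof.
move=> mf fB; apply: measurable_bounded_integrable => //.
exists B; split; first exact: num_real.
by move=> C BC x _; apply: le_trans (fB x) (ltW BC).
Qed.

Lemma bounded_measurable_cintegrable f : bounded_measurable f -> cintegrable mu f.
Proof.
move=> [rf mf [B fB]]; split.
- apply: (@bounded_measurable_integrable _ B) => // x.
  by apply: le_trans (ler_Re_normc _) _.
- apply: (@bounded_measurable_integrable _ B) => // x.
  by apply: le_trans (ler_Im_normc _) _.
Qed.

Lemma cintegralD f g : bounded_measurable f -> bounded_measurable g ->
  cintegral mu (fun x => f x + g x) = cintegral mu f + cintegral mu g.
Proof.
move=> /bounded_measurable_cintegrable[rf mf] /bounded_measurable_cintegrable[rg mg].
apply/eqP; rewrite eq_complex /=; apply/andP; split; apply/eqP.
- by rewrite -RintegralD//; apply: eq_Rintegral => x _; rewrite raddfD.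
- by rewrite -RintegralD//; apply: eq_Rintegral => x _; rewrite raddfD.
Qed.

Lemma cintegralZ (c : R[i]) f : bounded_measurable f ->
  cintegral mu (fun x => c * f x) = c * cintegral mu f.
Proof.
move=> bf; have [rf mf] := bounded_measurable_cintegrable bf.
case: c => a b; apply/eqP; rewrite eq_complex /=; apply/andP; split; apply/eqP.
- rewrite -!RintegralZl// -RintegralB//=; last 2 first.
  + exact: (integrableZl measurableT a rf).
  + exact: (integrableZl measurableT b mf).
  by apply: eq_Rintegral => x _; case: (f x).
- rewrite -!RintegralZl// -RintegralD//=; last 2 first.
  + exact: (integrableZl measurableT a mf).
  + exact: (integrableZl measurableT b rf).
  by apply: eq_Rintegral => x _; case: (f x).
Qed.

Lemma cintegral_cst (c : R[i]) :
  cintegral mu (fun=> c) = c * real_complex R (fine (mu setT)).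
Proof.
by rewrite /cintegral !Rintegral_cst//; case: c => a b; apply/eqP;
  rewrite eq_complex/= !mulr0 subr0 add0r !eqxx.
Qed.

Lemma cintegral_sum (I : Type) (r : seq I) (F : I -> T -> R[i]) :
  (forall i, bounded_measurable (F i)) ->
  cintegral mu (fun x => \sum_(i <- r) F i x) = \sum_(i <- r) cintegral mu (F i).
Proof.
move=> bF; elim: r => [|i r ih].
  by under eq_fun do rewrite big_nil; rewrite cintegral_cst mul0r big_nil.
under eq_fun do rewrite big_cons.
by rewrite cintegralD// ?ih ?big_cons//; exact: bounded_measurable_sum.
Qed.

(** The factor 2 comes from bounding the real and the imaginary part separately. *)
Lemma normc_cintegral f (B : R) : bounded_measurable f ->
  (forall x, normc (f x) <= B) ->
  normc (cintegral mu f) <= 2 * fine (mu setT) * B.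
Proof.
move=> bf fB; have [rf mf] := bounded_measurable_cintegrable bf.
have le_real (h : T -> R) : mu.-integrable setT (EFin \o h) ->
    (forall x, `|h x| <= B) -> `|\int[mu]_x h x| <= fine (mu setT) * B.
  move=> ih hB; apply: le_trans (le_normr_Rintegral _ ih) _ => //.
  rewrite mulrC -(@Rintegral_cst _ _ _ mu setT)//; apply: le_Rintegral => //.
  - rewrite (_ : EFin \o _ = abse \o (EFin \o h)); last exact/funext.
    exact: integrable_abse.
  - exact: finite_measure_integrable_cst.
apply: le_trans (normc_le_ReIm _) _.
rewrite -mulrA mulr_natl mulr2n; apply: lerD; apply: le_real => // x.
- by apply: le_trans (fB x); exact: ler_Re_normc.
- by apply: le_trans (fB x); exact: ler_Im_normc.
Qed.

End cintegral_theory.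

Section cintegral_product.
Context {R : realType} d d' (T : measurableType d) (U : measurableType d').
Variables (mu : {finite_measure set T -> \bar R}).
Variables (nu : {finite_measure set U -> \bar R}).

Lemma product_finite_lty : ((mu \x nu) setT < +oo)%E.
Proof.
rewrite -setXTT product_measure1E// lte_mul_pinfty//.
  exact: fin_num_measure.
by rewrite fin_num_fun_lty//; exact: fin_num_measure.
Qed.

Lemma product_bounded_measurable_integrable (f : T * U -> R) (B : R) :
  measurable_fun setT f -> (forall x, `|f x| <= B) ->
  (mu \x nu)%E.-integrable setT (EFin \o f).
Proof.
move=> mf fB; apply: measurable_bounded_integrable => //.
  exact: product_finite_lty.
exists B; split; first exact: num_real.
by move=> C BC x _; apply: le_trans (fB x) (ltW BC).
Qed.

Lemma product_bounded_measurable_cintegrable (f : T * U -> R[i]) :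
  bounded_measurable f -> cintegrable (mu \x nu)%E f.
Proof.
move=> [rf mf [B fB]]; split.
- apply: (@product_bounded_measurable_integrable _ B) => // x.
  by apply: le_trans (ler_Re_normc _) _.
- apply: (@product_bounded_measurable_integrable _ B) => // x.
  by apply: le_trans (ler_Im_normc _) _.
Qed.

Lemma cintegral_product (f : T -> R[i]) (g : U -> R[i]) :
  bounded_measurable f -> bounded_measurable g ->
  cintegral (mu \x nu)%E (fun x => f x.1 * g x.2) = cintegral mu f * cintegral nu g.
Proof.
move=> bf bg.
have bfg : bounded_measurable (fun x : T * U => f x.1 * g x.2).
  apply: bounded_measurableM.
    by apply: (bounded_measurable_comp (h := fst)) bf; exact: measurable_fst.
  by apply: (bounded_measurable_comp (h := snd)) bg; exact: measurable_snd.
have [rfg ifg [B fgB]] := bfg.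
have real_product (h : T * U -> R) : measurable_fun setT h ->
    (forall x, `|h x| <= B) ->
    \int[(mu \x nu)%E]_z h z = \int[nu]_y \int[mu]_x h (x, y).
  move=> mh hB; congr fine.
  rewrite -(integral21_prod_meas1 (product_bounded_measurable_integrable mh hB)).
  apply: eq_integral => y _; rewrite fineK//.
  apply: integrable_fin_num => //.
  apply: (@bounded_measurable_integrable _ _ _ mu _ B) => //.
  exact: measurable_fun_pair1.
transitivity (cintegral nu (fun y => cintegral mu (fun x => f x * g y))).
  apply/eqP; rewrite eq_complex /=; apply/andP; split; apply/eqP.
  - by apply: real_product => // x; apply: le_trans (ler_Re_normc _) _.
  - by apply: real_product => // x; apply: le_trans (ler_Im_normc _) _.
under eq_fun do under eq_fun do rewrite mulrC.
under eq_fun do rewrite cintegralZ// mulrC.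
by rewrite cintegralZ.
Qed.

End cintegral_product.

Lemma bounded_measurable_cintegral (R : realType) d d' (T : measurableType d)
    (U : measurableType d') (mu : {finite_measure set T -> \bar R})
    (f : T * U -> R[i]) : bounded_measurable f ->
  bounded_measurable (fun y => cintegral mu (fun x => f (x, y))).
Proof.
move=> bf; have [rf mf [B fB]] := bf.
(* The Fubini lemmas speak of a product measure; a Dirac mass serves as auxiliary finite measure on
   [U]. *)
pose nu : {finite_measure set U -> \bar R} := \d_(point : U).
have [irf imf] := product_bounded_measurable_cintegrable mu nu bf.
have mG (h : T * U -> R) : (mu \x nu)%E.-integrable setT (EFin \o h) ->
    measurable_fun setT (fun y => \int[mu]_x h (x, y)).
  move=> ih; apply: (measurableT_comp (@fine_measurable _ _ measurableT)) => //.
  exact: (measurable_fubini_G ih).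
split; [exact: (mG (fun z => complex.Re (f z)))|exact: (mG (fun z => complex.Im (f z)))|].
exists (2 * fine (mu setT) * B) => y; apply: normc_cintegral => //.
by apply: (bounded_measurable_comp (h := fun x => (x, y))) bf; exact: pair2_measurable.
Qed.

(** * Double integrals and separable kernels *)

Section double_integral.
Context {R : realType} d (T : measurableType d).
Variable mu : {finite_measure set T -> \bar R}.

(** The inner integral runs over the first variable, as in the coefficient formula. *)
Definition cintegral2 (Q : T * T -> R[i]) : R[i] :=
  cintegral mu (fun y => cintegral mu (fun x => Q (x, y))).

Lemma bounded_measurable_sectionl (Q : T * T -> R[i]) y :
  bounded_measurable Q -> bounded_measurable (fun x => Q (x, y)).
Proof.
by apply: (bounded_measurable_comp (h := fun x => (x, y))); exact: pair2_measurable.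
Qed.

Lemma bounded_measurable_tensor (f g : T -> R[i]) :
  bounded_measurable f -> bounded_measurable g ->
  bounded_measurable (fun z : T * T => f z.1 * g z.2).
Proof.
move=> bf bg; apply: bounded_measurableM.
  by apply: (bounded_measurable_comp (h := fst)) bf; exact: measurable_fst.
by apply: (bounded_measurable_comp (h := snd)) bg; exact: measurable_snd.
Qed.

Lemma cintegral2_dist (Q Q' : T * T -> R[i]) (e : R) :
  bounded_measurable Q -> bounded_measurable Q' ->
  (forall z, normc (Q z - Q' z) <= e) ->
  normc (cintegral2 Q - cintegral2 Q') <= (2 * fine (mu setT)) ^+ 2 * e.
Proof.
move=> bQ bQ' QQ'.
(* The difference is written with a factor [-1], so that additivity and homogeneity of the integral
   apply; the bound on a single integral is then used twice. *)
have bN (U : T -> R[i]) : bounded_measurable U -> bounded_measurable (fun x => -1 * U x).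
  by apply: bounded_measurableM; exact: bounded_measurable_cst.
have -> : cintegral2 Q - cintegral2 Q' =
    cintegral mu (fun y => cintegral mu (fun x => Q (x, y) + -1 * Q' (x, y))).
  rewrite /cintegral2 -[- cintegral _ _]mulN1r -cintegralZ; last exact: bounded_measurable_cintegral.
  rewrite -cintegralD; last 2 first.
  - exact: bounded_measurable_cintegral.
  - by apply: bN; exact: bounded_measurable_cintegral.
  congr cintegral; apply/funext => y.
  rewrite cintegralD ?cintegralZ//; try exact: bounded_measurable_sectionl.
  by apply: bN; exact: bounded_measurable_sectionl.
have bD : bounded_measurable (fun z => Q z + -1 * Q' z).
  apply: bounded_measurableD => //.
  by apply: bounded_measurableM => //; exact: bounded_measurable_cst.
rewrite expr2 -mulrA; apply: normc_cintegral; first exact: (bounded_measurable_cintegral mu bD).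
move=> y; apply: normc_cintegral.
  exact: (bounded_measurable_sectionl y bD).
by move=> x; rewrite mulN1r.
Qed.

Lemma bounded_measurable_separable (I : Type) (r : seq I) (c : I -> R[i])
    (f g : I -> T -> R[i]) :
  (forall i, bounded_measurable (f i)) -> (forall i, bounded_measurable (g i)) ->
  bounded_measurable (fun z : T * T => \sum_(i <- r) c i * (f i z.1 * g i z.2)).
Proof.
move=> bf bg; apply: bounded_measurable_sum => i; apply: bounded_measurableM.
  exact: bounded_measurable_cst.
exact: bounded_measurable_tensor.
Qed.

Lemma cintegral2_separable (I : Type) (r : seq I) (c : I -> R[i])
    (f g : I -> T -> R[i]) :
  (forall i, bounded_measurable (f i)) -> (forall i, bounded_measurable (g i)) ->
  cintegral2 (fun z => \sum_(i <- r) c i * (f i z.1 * g i z.2)) =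
  \sum_(i <- r) c i * (cintegral mu (f i) * cintegral mu (g i)).
Proof.
move=> bf bg.
have bM (k : R[i]) (U : T -> R[i]) :
    bounded_measurable U -> bounded_measurable (fun x => k * U x).
  by apply: bounded_measurableM; exact: bounded_measurable_cst.
transitivity (cintegral mu
    (fun y => \sum_(i <- r) c i * cintegral mu (f i) * g i y)).
  congr cintegral; apply/funext => y.
  rewrite (_ : (fun _ => _) = fun x => \sum_(i <- r) (c i * g i y) * f i x).
    rewrite cintegral_sum; last by move=> i; exact: bM.
    by apply: eq_bigr => i _; rewrite cintegralZ// mulrAC.
  by apply/funext => x; apply: eq_bigr => i _ /=; rewrite -mulrA (mulrC (f i x)).
rewrite cintegral_sum; last by move=> i; exact: bM.
by apply: eq_bigr => i _; rewrite cintegralZ// mulrA.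
Qed.

Lemma cintegral2_lin (I : Type) (r : seq I) (c : I -> R[i]) (Q : I -> T * T -> R[i]) :
  (forall i, bounded_measurable (Q i)) ->
  cintegral2 (fun z => \sum_(i <- r) c i * Q i z) =
  \sum_(i <- r) c i * cintegral2 (Q i).
Proof.
move=> bQ; rewrite /cintegral2.
have bM (k : R[i]) (f : T -> R[i]) :
    bounded_measurable f -> bounded_measurable (fun x => k * f x).
  by apply: bounded_measurableM; exact: bounded_measurable_cst.
transitivity (cintegral mu
    (fun y => \sum_(i <- r) c i * cintegral mu (fun x => Q i (x, y)))).
  congr cintegral; apply/funext => y; rewrite cintegral_sum; last first.
    by move=> i; apply: bM; exact: bounded_measurable_sectionl.
  by apply: eq_bigr => i _; rewrite cintegralZ//; exact: bounded_measurable_sectionl.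
rewrite cintegral_sum; last by move=> i; apply: bM; exact: bounded_measurable_cintegral.
by apply: eq_bigr => i _; rewrite cintegralZ//; exact: bounded_measurable_cintegral.
Qed.

End double_integral.

Section uniformly_separable.
Context {R : realType} d (T : measurableType d).

(** Uniform limits of finite sums of products [f x * g y]. The index type may vary with [e]; a list
    over an [eqType] allows bounds and partitions to be chosen for the finitely many [i \in r]
    only. *)
Definition uniformly_separable (Q : T * T -> R[i]) : Prop :=
  forall e : R, 0 < e -> exists (I : eqType) (r : seq I) (f g : I -> T -> R[i]),
    [/\ forall i, bounded_measurable (f i), forall i, bounded_measurable (g i) &
    forall z, normc (\sum_(i <- r) f i z.1 * g i z.2 - Q z) <= e].

Lemma uniformly_separable_bm Q : uniformly_separable Q -> bounded_measurable Q.
Proof.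
move=> Qsep; apply: bounded_measurable_unif => e /Qsep[I [r [f [g [bf bg fgQ]]]]].
exists (fun z => \sum_(i <- r) f i z.1 * g i z.2) => //.
by apply: bounded_measurable_sum => i; exact: bounded_measurable_tensor.
Qed.

Lemma uniformly_separableD Q Q' : uniformly_separable Q -> uniformly_separable Q' ->
  uniformly_separable (fun z => Q z + Q' z).
Proof.
move=> sQ sQ' e e0; have e20 : 0 < e / 2 by rewrite divr_gt0.
have [I [r [f [g [bf bg fgQ]]]]] := sQ _ e20.
have [I' [r' [f' [g' [bf' bg' fgQ']]]]] := sQ' _ e20.
exists (I + I')%type, (map inl r ++ map inr r'),
  (fun i => match i with inl j => f j | inr j => f' j end),
  (fun i => match i with inl j => g j | inr j => g' j end).
split=> [[]//|[]//|z]; rewrite big_cat/= !big_map opprD addrACA [leRHS]splitr.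
by apply: le_trans (le_normcD _ _) _; exact: lerD.
Qed.

Lemma uniformly_separable_sum (I : Type) (r : seq I) (Q : I -> T * T -> R[i]) :
  (forall i, uniformly_separable (Q i)) ->
  uniformly_separable (fun z => \sum_(i <- r) Q i z).
Proof.
move=> sQ; elim: r => [|i r ih].
  move=> e e0; exists nat, [::], (fun _ _ => 0), (fun _ _ => 0).
  split=> [i|i|z]; [exact: bounded_measurable_cst|exact: bounded_measurable_cst|].
  by rewrite !big_nil subr0 ComplexField.Normc.normc0 ltW.
by under eq_fun do rewrite big_cons; exact: uniformly_separableD.
Qed.

(** Multiplication by a bounded tensor enlarges the error by at most [|A| * |B|]. This covers the
    kernels obtained from entries of [K] by multiplying with harmonics. *)
Lemma uniformly_separable_tensorM (a b : T -> R[i]) Q :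
  bounded_measurable a -> bounded_measurable b -> uniformly_separable Q ->
  uniformly_separable (fun z => a z.1 * b z.2 * Q z).
Proof.
move=> ba bb sQ e e0; have [_ _ [A aA]] := ba; have [_ _ [B bB]] := bb.
have den0 : 0 < `|A| * `|B| + 1 by rewrite ltr_wpDl// mulr_ge0.
have [I [r [f [g [bf bg fgQ]]]]] := sQ _ (divr_gt0 e0 den0).
exists I, r, (fun i x => a x * f i x), (fun i x => b x * g i x).
split=> [i|i|z]; [exact: bounded_measurableM|exact: bounded_measurableM|].
rewrite (_ : _ - _ = a z.1 * b z.2 * (\sum_(i <- r) f i z.1 * g i z.2 - Q z)).
  rewrite !ComplexField.Normc.normcM.
  apply: (@le_trans _ _ (`|A| * `|B| * (e / (`|A| * `|B| + 1)))).
    rewrite ler_pM ?mulr_ge0 ?normc_ge0//.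
    by rewrite ler_pM ?normc_ge0// (le_trans _ (ler_norm _)).
  by rewrite mulrCA ler_piMr ?(ltW e0)// ler_pdivrMr// mul1r lerDl.
by rewrite mulrBr mulr_sumr; congr (_ - _); apply: eq_bigr => i _; ring.
Qed.

End uniformly_separable.

(** * Nonnegativity of double integrals of positive definite kernels *)

Section positive_kernels.
Context {R : realType} d (T : measurableType d).

(** The range [[-B, B]] is cut into half-open intervals of length [e], and a point is labelled by
    the interval that contains its value. *)
Lemma real_finite_labelling (f : T -> R) (B e : R) :
  measurable_fun setT f -> (forall x, `|f x| <= B) -> 0 < e ->
  exists (J : finType) (c : T -> J), (forall j, measurable (c @^-1` [set j])) /\
    forall x y, c x = c y -> `|f x - f y| <= e.
Proof.
move=> mf fB e0.
(* After this shift and scaling the label is the integer part; equal integer parts force a distance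
   of at most 1, that is, [e] for [f]. *)
pose h x := (f x + B) / e.
have h0 x : 0 <= h x.
  by rewrite divr_ge0 ?(ltW e0)//; have := fB x; rewrite ler_norml => /andP[]; lra.
pose n := Num.truncn ((B + B) / e).
have hn x : (Num.truncn (h x) < n.+1)%N.
  rewrite ltnS; apply: le_truncn; rewrite ler_pM2r ?invr_gt0// lerD2r.
  by apply: le_trans (ler_norm _) _.
exists 'I_n.+1, (fun x => Ordinal (hn x)); split.
- move=> j; rewrite (_ : _ @^-1` _ = f @^-1` `[j%:R * e - B, j.+1%:R * e - B[%classic).
    by rewrite -[X in measurable X]setTI; apply: mf => //; exact: measurable_itv.
  apply/seteqP; split => x /=; rewrite in_itv/= lerBlDr ltrBrDr.
    move=> <- /=; have /andP[] := truncn_itv (h0 x).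
    by rewrite /h ler_pdivlMr// ltr_pdivrMr// => -> ->.
  rewrite -ler_pdivlMr// -ltr_pdivrMr// => /andP[jh hj]; apply/val_inj => /=.
  by apply/eqP; rewrite truncn_eq ?h0// jh.
- move=> x y [xy]; have /andP[x1 x2] := truncn_itv (h0 x).
  have /andP[y1 y2] := truncn_itv (h0 y).
  have : `|h x - h y| <= 1.
    move: x1 x2 y1 y2; rewrite xy -natr1 => x1 x2 y1 y2.
    by rewrite ler_norml; apply/andP; split; lra.
  rewrite /h -mulrBl opprD addrACA subrr addr0 normrM normfV (gtr0_norm e0).
  by rewrite ler_pdivrMr// mul1r.
Qed.

(** By induction on the list, the partition is refined by labels for the real and the imaginary part
    of each function, with tolerance [e / 2] each. *)
Lemma finite_labelling (I : eqType) (r : seq I) (f : I -> T -> R[i]) (e : R) :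
  (forall i, bounded_measurable (f i)) -> 0 < e ->
  exists (J : finType) (c : T -> J), (forall j, measurable (c @^-1` [set j])) /\
    forall x y, c x = c y -> forall i, i \in r -> normc (f i x - f i y) <= e.
Proof.
move=> bf e0; elim: r => [|i r [J [c [mc cP]]]].
  exists unit, (fun=> tt); split => // j.
  by rewrite (_ : _ @^-1` _ = setT)//; apply/seteqP; split => // x _; case: j.
have [rf mf [B fB]] := bf i.
have e20 : 0 < e / 2 by rewrite divr_gt0.
have [J1 [c1 [mc1 c1P]]] := real_finite_labelling rf
  (fun x => le_trans (ler_Re_normc (f i x)) (fB x)) e20.
have [J2 [c2 [mc2 c2P]]] := real_finite_labelling mf
  (fun x => le_trans (ler_Im_normc (f i x)) (fB x)) e20.
exists (J * (J1 * J2))%type, (fun x => (c x, (c1 x, c2 x))); split.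
- move=> [j [j1 j2]].
  rewrite (_ : _ @^-1` _ = c @^-1` [set j] `&` (c1 @^-1` [set j1] `&` c2 @^-1` [set j2])).
    by apply: measurableI => //; exact: measurableI.
  by apply/seteqP; split => x /= [-> [-> ->]].
- move=> x y [xy xy1 xy2] k; rewrite inE => /predU1P[->|/(cP _ _ xy)//].
  apply: le_trans (normc_le_ReIm _) _; rewrite !raddfB/= [leRHS]splitr.
  by apply: lerD; [exact: c1P|exact: c2P].
Qed.

Variable mu : {finite_measure set T -> \bar R}.

(* A positive definite kernel stays nonnegative after replacing every point by
   the representative of its cell in a finite measurable partition; for
   uniform limits of separable kernels the error of this is uniformly small. *)
Lemma cintegral2_ge0 (Q : T * T -> R[i]) : uniformly_separable Q ->
  (forall (J : finType) (x : J -> T) (w : J -> R), (forall j, 0 <= w j) ->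
    0 <= \sum_i \sum_j Q (x i, x j) * (real_complex R (w i) * real_complex R (w j))) ->
  0 <= cintegral2 mu Q.
Proof.
move=> Qsep Qpd.
have bQ := uniformly_separable_bm Qsep.
(* The factor 3 counts the errors: twice the distance between [Q] and its separable approximant, and
   once the variation of the approximant within a cell. *)
apply: (@normc_ge0_approx _ _ ((2 * fine (mu setT)) ^+ 2 * 3)).
  by rewrite mulr_ge0// sqr_ge0.
move=> e e0; have [I [r [f [g [bf bg fgQ]]]]] := Qsep e e0.
have [B B0 fgB] : exists2 B : R, 0 <= B &
    forall i, i \in r -> forall x, normc (f i x) <= B /\ normc (g i x) <= B.
  elim: r {fgQ} => [|i r [B B0 BP]]; first by exists 0.
  have [_ _ [B1 fB1]] := bf i; have [_ _ [B2 gB2]] := bg i.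
  exists (B + `|B1| + `|B2|); first by rewrite !addr_ge0.
  move=> k; rewrite inE => /predU1P[-> x|/BP h x].
    split; [apply: le_trans (fB1 x) _|apply: le_trans (gB2 x) _];
      apply: le_trans (ler_norm _) _.
      by rewrite addrAC lerDr addr_ge0.
    by rewrite lerDr addr_ge0.
  by have [h1 h2] := h x; split; rewrite -addrA (le_trans h1, le_trans h2)// lerDl addr_ge0.
(* Within a cell each product changes by at most [2 * B * del], so the sum over [r] changes by at
   most [e]; the summand 1 keeps the denominator positive. *)
pose del := e / ((size r)%:R * (2 * B) + 1).
have den0 : 0 < (size r)%:R * (2 * B) + 1.
  by rewrite ltr_wpDl// mulr_ge0// mulr_ge0.
have del0 : 0 < del by rewrite divr_gt0.
have [J1 [c1 [mc1 c1P]]] := finite_labelling r bf del0.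
have [J2 [c2 [mc2 c2P]]] := finite_labelling r bg del0.
pose J := (J1 * J2)%type; pose c x : J := (c1 x, c2 x).
have mc (j : J) : measurable (c @^-1` [set j]).
  case: j => j1 j2.
  rewrite (_ : _ @^-1` _ = c1 @^-1` [set j1] `&` c2 @^-1` [set j2]).
    exact: measurableI.
  by apply/seteqP; split => x; rewrite /c/= => -[-> ->].
(* A representative of each cell; labels of empty cells get the default [point], and their
   indicators vanish. *)
have [x0 xP] : exists rep : J -> T, forall x, c (rep (c x)) = c x.
  exists (fun j => xget point [set x | c x = j]) => x.
  by case: xgetP => [y _ //|/(_ x)]; case.
pose chi (j : J) x : R[i] := (c x == j)%:R.
have chiE j : chi j = fun x => real_complex R (\1_(c @^-1` [set j]) x).
  apply/funext => x; rewrite /chi indicE -(rmorph_nat (real_complex R)).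
  by congr (real_complex R _%:R); congr nat_of_bool; apply/eqP/idP; rewrite inE.
have bchi j : bounded_measurable (chi j).
  rewrite chiE; split; [exact: measurable_indic|exact: measurable_cst|].
  by exists 1 => x; rewrite normc_real indicE; case: (_ \in _); rewrite ?normr1 ?normr0 ?ler01.
(* The weights are the measures of the cells. *)
have [w w0 chiw] : exists2 w : J -> R, (forall j, 0 <= w j) &
    forall j, cintegral mu (chi j) = real_complex R (w j).
  exists (fun j => \int[mu]_x \1_(c @^-1` [set j]) x).
    by move=> j; apply: Rintegral_ge0.
  move=> j; rewrite chiE /cintegral/=; apply/eqP; rewrite eq_complex/= eqxx/=.
  by rewrite Rintegral_cst// mul0r.
(* The step kernel: [Q] evaluated at representatives. Being a finite separable sum, it integrates to
   a weighted quadratic form, which [Qpd] makes nonnegative. *)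
pose Q' z := \sum_(p : J * J) Q (x0 p.1, x0 p.2) * (chi p.1 z.1 * chi p.2 z.2).
have Q'E z : Q' z = Q (x0 (c z.1), x0 (c z.2)).
  rewrite /Q' (bigD1 (c z.1, c z.2))//= /chi !eqxx !mulr1 big1 ?addr0//.
  move=> [i j] /= ij; case: (eqVneq (c z.1) i) => [i1|]; last by rewrite mul0r mulr0.
  case: (eqVneq (c z.2) j) => [j1|]; last by rewrite !mulr0.
  by move: ij; rewrite i1 j1 eqxx.
have bQ' : bounded_measurable Q'.
  exact: (bounded_measurable_separable _ _ (f := fun p => chi p.1) (g := fun p => chi p.2)).
exists (cintegral2 mu Q').
  rewrite /Q' (cintegral2_separable _ _ _ (f := fun p => chi p.1)
    (g := fun p => chi p.2))//.
  under eq_bigr do rewrite !chiw.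
  by rewrite -(pair_bigA _ (fun i j => Q (x0 i, x0 j) *
    (real_complex R (w i) * real_complex R (w j))))/=; exact: Qpd.
rewrite -mulrA; apply: cintegral2_dist => // -[x y].
pose S (z : T * T) := \sum_(i <- r) f i z.1 * g i z.2.
have SS' : normc (S (x, y) - S (x0 (c x), x0 (c y))) <= e.
  rewrite /S -sumrB /=; apply: le_trans (normc_sum _ _) _.
  apply: (@le_trans _ _ (\sum_(i <- r) (2 * B) * del)).
    rewrite big_seq [leRHS]big_seq; apply: ler_sum => i ir.
    have -> : f i x * g i y - f i (x0 (c x)) * g i (x0 (c y)) =
      (f i x - f i (x0 (c x))) * g i y + f i (x0 (c x)) * (g i y - g i (x0 (c y))).
      by ring.
    apply: le_trans (le_normcD _ _) _; rewrite !ComplexField.Normc.normcM.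
    have [_ gy] := fgB i ir y; have [fx _] := fgB i ir (x0 (c x)).
    have fx' : normc (f i x - f i (x0 (c x))) <= del.
      by apply: c1P => //; case: (xP x).
    have gy' : normc (g i y - g i (x0 (c y))) <= del.
      by apply: c2P => //; case: (xP y).
    rewrite mulr_natl mulr2n mulrDl; apply: lerD; last by apply: ler_pM; rewrite ?normc_ge0.
    by rewrite mulrC; apply: ler_pM; rewrite ?normc_ge0.
  rewrite big_const_seq count_predT iter_addr_0 -[leLHS]mulr_natl mulrA.
  by rewrite /del mulrCA ler_piMr ?(ltW e0)// ler_pdivrMr// mul1r lerDl.
rewrite Q'E /=.
have -> : Q (x, y) - Q (x0 (c x), x0 (c y)) = - (S (x, y) - Q (x, y)) +
  ((S (x, y) - S (x0 (c x), x0 (c y))) + (S (x0 (c x), x0 (c y)) - Q (x0 (c x), x0 (c y)))).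
  by ring.
apply: le_trans (le_normcD _ _) _; rewrite normcN.
rewrite (_ : 3 * e = e + (e + e)); last by ring.
apply: lerD; first exact: (fgQ (x, y)).
by apply: le_trans (le_normcD _ _) _; apply: lerD => //; exact: (fgQ (_, _)).
Qed.

End positive_kernels.

(** * Uniformly convergent orthonormal expansions of kernels *)

Section orthonormal_expansion.
Context {R : realType} d (T : measurableType d).
Variable mu : {finite_measure set T -> \bar R}.
Variables (I : eqType) (E : nat -> seq I) (phi : I -> T -> R[i]).
Hypothesis E_uniq : forall n, uniq (E n).
Hypothesis E_cover : forall i, exists N, forall n, (N <= n)%N -> i \in E n.
Hypothesis phi_bm : forall i, bounded_measurable (phi i).
Hypothesis phi_orth : forall i j,
  cintegral mu (fun x => phi i x * conjc (phi j x)) = (i == j)%:R.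

Definition expansion_sum (c : I -> R[i]) (n : nat) (z : T * T) : R[i] :=
  \sum_(i <- E n) c i * (phi i z.1 * conjc (phi i z.2)).

(** Convergence is asked only along the exhaustion [E]; on the torus this will be the diagonal of
    the rectangular partial sums. *)
Definition expands_to (c : I -> R[i]) (k : T * T -> R[i]) : Prop :=
  forall e : R, 0 < e -> exists N, forall n, (N <= n)%N ->
    forall z, normc (expansion_sum c n z - k z) <= e.

Let phiJ_bm i : bounded_measurable (fun x => conjc (phi i x)).
Proof. exact: bounded_measurable_conj. Qed.

Lemma expansion_sum_bm c n : bounded_measurable (expansion_sum c n).
Proof.
exact: (bounded_measurable_separable _ _ (f := phi) (g := fun i x => conjc (phi i x))).
Qed.

Lemma expands_to_separable c k : expands_to c k -> uniformly_separable k.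
Proof.
move=> ck e /ck[N NP].
exists I, (E N), (fun i x => c i * phi i x), (fun i x => conjc (phi i x)).
split=> [i|//|z]; first by apply: bounded_measurableM => //; exact: bounded_measurable_cst.
by under eq_bigr do rewrite -mulrA; exact: NP.
Qed.

Lemma expands_to_bm c k : expands_to c k -> bounded_measurable k.
Proof.
move=> ck; apply: bounded_measurable_unif => e /ck[N NP].
by exists (expansion_sum c N); [exact: expansion_sum_bm|exact: NP].
Qed.

Let phi_orthC i j :
  cintegral mu (fun x => conjc (phi i x) * phi j x) = (i == j)%:R.
Proof.
by rewrite eq_sym -phi_orth; congr cintegral; apply/funext => x; rewrite mulrC.
Qed.

(** Orthonormality makes the weighted integral of a partial sum equal to [c i] as soon as [i] occurs
    in it. The weight is bounded, so uniform convergence carries this over to [k]. *)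
Lemma expansion_coefficient c k i : expands_to c k ->
  c i = cintegral2 mu (fun z => conjc (phi i z.1) * phi i z.2 * k z).
Proof.
move=> ck; apply/esym.
pose w (z : T * T) := conjc (phi i z.1) * phi i z.2.
have bw : bounded_measurable w.
  exact: (bounded_measurable_tensor (f := fun x => conjc (phi i x)) (g := phi i)).
have [_ _ [B wB]] := bw.
apply: normc_small_eq => e e0.
pose m2 := (2 * fine (mu setT)) ^+ 2.
have den0 : 0 < m2 * `|B| + 1 by rewrite ltr_wpDl// mulr_ge0// sqr_ge0.
have [N1 N1P] := E_cover i.
have [N2 N2P] := ck (e / (m2 * `|B| + 1)) (divr_gt0 e0 den0).
(* Past [N1] the index [i] occurs in the partial sum; past [N2] the partial sum is uniformly close
   to [k]. *)
pose n := maxn N1 N2.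
have -> : c i = cintegral2 mu (fun z => w z * expansion_sum c n z).
  rewrite (_ : (fun _ => _) = fun z => \sum_(j <- E n) c j *
      ((phi j z.1 * conjc (phi i z.1)) * (conjc (phi j z.2) * phi i z.2))).
    rewrite (cintegral2_separable _ _ _ (f := fun j x => phi j x * conjc (phi i x))
      (g := fun j x => conjc (phi j x) * phi i x)); last 2 first.
    - by move=> j; exact: bounded_measurableM.
    - by move=> j; exact: bounded_measurableM.
    rewrite (bigD1_seq i) ?E_uniq ?N1P ?leq_maxl//= phi_orth phi_orthC eqxx !mulr1.
    rewrite big1 ?addr0// => j /negPf ji.
    by rewrite phi_orth ji mul0r mulr0.
  apply/funext => z; rewrite /expansion_sum mulr_sumr; apply: eq_bigr => j _.
  by rewrite /w; ring.
apply: (@le_trans _ _ (m2 * (`|B| * (e / (m2 * `|B| + 1))))).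
  apply: cintegral2_dist.
  - by apply: bounded_measurableM => //; exact: (expands_to_bm ck).
  - by apply: bounded_measurableM => //; exact: expansion_sum_bm.
  - move=> z; rewrite -/(w z) -mulrBr ComplexField.Normc.normcM.
    apply: ler_pM; rewrite ?normc_ge0//.
      by apply: le_trans (wB z) (ler_norm _).
    by rewrite -normcN opprB; apply: N2P; exact: leq_maxr.
by rewrite mulrA mulrCA ler_piMr ?(ltW e0)// ler_pdivrMr// mul1r lerDl.
Qed.

(* Integrating [|S_n|^2] gives the sum of the squared coefficients. *)
Lemma expansion_coefficients_bounded c k : expands_to c k ->
  exists N (C : R), forall n, (N <= n)%N -> \sum_(i <- E n) normc (c i) ^+ 2 <= C.
Proof.
move=> ck; have [N NP] := ck 1 ltr01.
have [_ _ [B kB]] := expands_to_bm ck.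
(* From [N] on, partial sums are within 1 of [k], hence bounded by [1 + B]. *)
exists N, ((2 * fine (mu setT)) ^+ 2 * (1 + B) ^+ 2) => n Nn.
pose S := expansion_sum c n.
have bS : bounded_measurable S by exact: expansion_sum_bm.
have SB z : normc (S z) <= 1 + B.
  by rewrite -[S z](subrK (k z)); apply: le_trans (le_normcD _ _) _; apply: lerD; [exact: NP|].
pose Q z := S z * conjc (S z).
have bQ : bounded_measurable Q by apply: bounded_measurableM => //; exact: bounded_measurable_conj.
have JQ : cintegral2 mu Q = real_complex R (\sum_(i <- E n) normc (c i) ^+ 2).
  (* The squared modulus becomes a separable sum over pairs of indices, of which orthonormality
     leaves the diagonal. *)
  rewrite (_ : Q = fun z => \sum_(ij <- [seq (i, j) | i <- E n, j <- E n])
      (c ij.1 * conjc (c ij.2)) * ((phi ij.1 z.1 * conjc (phi ij.2 z.1)) *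
        (conjc (phi ij.1 z.2) * phi ij.2 z.2))).
    rewrite (cintegral2_separable _ _ _ (f := fun ij x => phi ij.1 x * conjc (phi ij.2 x))
      (g := fun ij x => conjc (phi ij.1 x) * phi ij.2 x)); last 2 first.
    - by move=> ij; exact: bounded_measurableM.
    - by move=> ij; exact: bounded_measurableM.
    rewrite big_allpairs rmorph_sum/= big_seq [RHS]big_seq; apply: eq_bigr => i iE.
    rewrite (bigD1_seq i) ?E_uniq//= phi_orth phi_orthC eqxx !mulr1.
    rewrite big1 ?addr0 ?mul_conjc_normc// => j /negPf ji.
    by rewrite phi_orth eq_sym ji mul0r mulr0.
  apply/funext => z; rewrite /Q /S /expansion_sum rmorph_sum/= big_allpairs mulr_suml.
  apply: eq_bigr => i _; rewrite mulr_sumr; apply: eq_bigr => j _.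
  by rewrite !rmorphM/= conjcK; ring.
(* Comparison with the zero kernel bounds the integral of [Q] itself. *)
have := @cintegral2_dist _ _ _ mu Q (fun=> 0) ((1 + B) ^+ 2) bQ (bounded_measurable_cst _ 0).
have -> : cintegral2 mu (fun=> 0) = 0 by rewrite /cintegral2 !cintegral_cst !mul0r.
rewrite subr0 JQ normc_real; move=> h; apply: le_trans (ler_norm _) (h _) => z.
by rewrite subr0 /Q ComplexField.Normc.normcM normc_conj expr2 ler_pM// normc_ge0.
Qed.

End orthonormal_expansion.

(** * Positive definiteness of a kernel and of its coefficients *)

Section positive_definite_kernels.
Context {R : realType}.

(** Enumerating [J] allows quadratic forms indexed by any finite type, such as pairs of a cell and
    an index. *)
Lemma positive_definite_fin (X : Type) p (G : X -> X -> 'M[R[i]]_p) (J : finType)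
    (x : J -> X) (a : J -> 'cV[R[i]]_p) : positive_definite G ->
  0 <= \sum_k \sum_h
    ((a k)^T *m G (x k) (x h) *m map_mx (@conjc R) (a h)) 0 0.
Proof.
move=> [_ /(_ #|J| (x \o enum_val) (a \o enum_val))].
rewrite (reindex (@enum_val J xpredT))/=; last by apply: onW_bij; exact: enum_val_bij.
under eq_bigr do rewrite -(reindex (@enum_val J xpredT) (onW_bij _ (@enum_val_bij J)) (P := xpredT)
  (F := fun h => (_ *m G _ (x h) *m map_mx (@conjc R) (a h)) 0 0))/=.
by [].
Qed.

Lemma quad_formE p (M : 'M[R[i]]_p) (a b : 'cV[R[i]]_p) :
  (a^T *m M *m map_mx (@conjc R) b) 0 0 =
  \sum_l \sum_m a l 0 * M l m * conjc (b m 0).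
Proof.
rewrite mxE exchange_big/=; apply: eq_bigr => m _.
by rewrite !mxE mulr_suml; apply: eq_bigr => l _; rewrite !mxE.
Qed.

Variables (d : measure_display) (T : measurableType d) (U : Type) (p : nat).
Variable mu : {finite_measure set T -> \bar R}.
Variables (I : eqType) (E : nat -> seq I) (phi : I -> T -> R[i]).
Hypothesis E_uniq : forall n, uniq (E n).
Hypothesis E_cover : forall i, exists N, forall n, (N <= n)%N -> i \in E n.
Hypothesis phi_bm : forall i, bounded_measurable (phi i).
Hypothesis phi_orth : forall i j,
  cintegral mu (fun x => phi i x * conjc (phi j x)) = (i == j)%:R.
Variables (K : T * U -> T * U -> 'M[R]_p) (c : I -> U -> U -> 'M[R[i]]_p).
Hypothesis K_exp : forall u u' l m, expands_to E phi (fun i => c i u u' l m)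
  (fun z => real_complex R (K (z.1, u) (z.2, u') l m)).

Lemma coefficients_hermitian i u u' :
  (forall a b, K a b = (K b a)^T) -> c i u u' = (map_mx (@conjc R) (c i u' u))^T.
Proof.
move=> KT; apply/matrixP => l m; rewrite !mxE.
rewrite (expansion_coefficient E_uniq E_cover phi_bm phi_orth i (K_exp u u' l m)).
(* Since [K] is real and symmetric, conjugating the expansion of the [(m, l)] entry at [(u', u)] and
   exchanging the two points gives an expansion of the [(l, m)] entry at [(u, u')]; the integral
   formula determines its coefficients. *)
rewrite -(expansion_coefficient E_uniq E_cover phi_bm phi_orth i
  (c := fun i => conjc (c i u' u m l)))// => e /(K_exp u' u m l)[N NP].
exists N => n /NP h [x y]; rewrite -normc_conj rmorphB/= oppr0.
have := h (y, x); rewrite /= KT mxE /expansion_sum => h'.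
apply: le_trans h'; rewrite le_eqVlt; apply/orP; left; apply/eqP; congr (normc (_ - _)).
rewrite rmorph_sum/=; apply: eq_bigr => j _.
by rewrite !rmorphM/= !conjcK; congr (_ * _); rewrite mulrC.
Qed.

Lemma coefficients_positive_definite i :
  positive_definite (fun a b => map_mx (real_complex R) (K a b)) ->
  positive_definite (c i).
Proof.
move=> Kpd.
have KT a b : K a b = (K b a)^T.
  have [/(_ a b) + _] := Kpd; move=> /matrixP h; apply/matrixP => l m.
  by have := h l m; rewrite !mxE/= oppr0 => -[].
split; first by move=> u u'; exact: coefficients_hermitian.
move=> n u a.
(* An element of [q] collects two point indices and two matrix indices, so that the quadratic form
   becomes a single linear combination of double integrals. *)
pose q := ('I_n * 'I_n * ('I_p * 'I_p))%type.
pose coef (t : q) := a t.1.1 t.2.1 0 * conjc (a t.1.2 t.2.2 0).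
pose kern (t : q) (z : T * T) := conjc (phi i z.1) * phi i z.2 *
  real_complex R (K (z.1, u t.1.1) (z.2, u t.1.2) t.2.1 t.2.2).
have skern t : uniformly_separable (kern t).
  apply: (uniformly_separable_tensorM (a := fun x => conjc (phi i x))) => //.
    exact: bounded_measurable_conj.
  exact: expands_to_separable (K_exp _ _ _ _).
pose Q z := \sum_(t : q) coef t * kern t z.
have -> : \sum_(k < n) \sum_(h < n)
   ((a k)^T *m c i (u k) (u h) *m map_mx (@conjc R) (a h)) 0 0 = cintegral2 mu Q.
  rewrite /Q cintegral2_lin; last by move=> t; exact: uniformly_separable_bm.
  rewrite pair_bigA/= -(pair_bigA _ (fun kh lm => coef (kh, lm) *
    cintegral2 mu (kern (kh, lm))))/=; apply: eq_bigr => -[k h] _ /=.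
  rewrite quad_formE pair_bigA/=; apply: eq_bigr => -[l m] _ /=.
  rewrite (expansion_coefficient E_uniq E_cover phi_bm phi_orth i (K_exp (u k) (u h) l m)).
  by rewrite mulrAC.
apply: cintegral2_ge0.
  apply: uniformly_separable_sum => t.
  (* A scalar is a tensor of two constant functions. *)
  rewrite (_ : (fun _ => _) = fun z => coef t * 1 * kern t z); last first.
    by apply/funext => z; rewrite mulr1.
  apply: (uniformly_separable_tensorM (a := fun=> coef t) (b := fun=> 1)) => //;
    exact: bounded_measurable_cst.
move=> J x w w0.
(* The weighted sum of [Q] is the quadratic form of [K] at the points [(x j, u k)] with vectors
   [w j * conjc (phi i (x j)) *: a k]. *)
have := positive_definite_fin (J := (J * 'I_n)%type) (fun jk => (x jk.1, u jk.2))
  (fun jk => (real_complex R (w jk.1) * conjc (phi i (x jk.1))) *: a jk.2) Kpd.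
congr (0 <= _).
rewrite -(pair_bigA _ (fun j k => \sum_(h : (J * 'I_n)%type) (((real_complex R (w j)
  * conjc (phi i (x j))) *: a k)^T *m map_mx (real_complex R) (K (x j, u k) (x h.1, u h.2))
  *m map_mx (@conjc R) ((real_complex R (w h.1) * conjc (phi i (x h.1))) *: a h.2)) 0 0))/=.
apply: eq_bigr => j1 _.
under eq_bigr do rewrite -(pair_bigA _ (fun j' h => ((_ *: a _)^T *m
  map_mx (real_complex R) (K _ (x j', u h))
  *m map_mx (@conjc R) ((real_complex R (w j') * conjc (phi i (x j'))) *: a h)) 0 0))/=.
rewrite exchange_big/=; apply: eq_bigr => j2 _.
rewrite /Q mulr_suml -(pair_bigA _ (fun kh lm => coef (kh, lm) * kern (kh, lm) (x j1, x j2) *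
   (real_complex R (w j1) * real_complex R (w j2))))/= pair_bigA/=.
apply: eq_bigr => -[k h] _ /=; rewrite quad_formE pair_bigA/=; apply: eq_bigr => -[l m] _ /=.
have conjE (r : R) (z v : R[i]) :
    conjc (real_complex R r * conjc z * v) = real_complex R r * z * conjc v.
  by rewrite -[X in X * _ * conjc v]conjc_real -[X in _ * X * conjc v]conjcK -!rmorphM.
rewrite !mxE conjE /coef /kern/=.
by ring.
Qed.

Let entry (n : nat) (a b : T * U) (l m : 'I_p) : R[i] :=
  expansion_sum E phi (fun i => c i a.2 b.2 l m) n (a.1, b.1).

Lemma expansion_positive_definite :
  (forall i, positive_definite (c i)) ->
  positive_definite (fun a b => map_mx (real_complex R) (K a b)).
Proof.
move=> cpd; split.
  move=> [x u] [y v]; apply/matrixP => l m; rewrite !mxE.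
  apply: normc_small_eq => e e0; have e20 : 0 < e / 2 by rewrite divr_gt0.
  have [N1 N1P] := K_exp u v l m e20.
  have [N2 N2P] := K_exp v u m l e20.
  pose n := maxn N1 N2.
  have := N1P n (leq_maxl _ _) (x, y); have := N2P n (leq_maxr _ _) (y, x).
  rewrite /= -normc_conj rmorphB/=.
  (* Each partial sum is Hermitian, because its coefficients are. *)
  have -> : conjc (expansion_sum E phi (fun i => c i v u m l) n (y, x)) =
     expansion_sum E phi (fun i => c i u v l m) n (x, y).
    rewrite /expansion_sum rmorph_sum; apply: eq_bigr => i _ /=.
    rewrite !rmorphM/= conjcK (mulrC (conjc _) (phi i x)); congr (_ * _).
    by have [/(_ u v) /matrixP/(_ l m) + _] := cpd i; rewrite !mxE.
  set S := expansion_sum _ _ _ _ _.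
  move=> h1 h2; rewrite [leRHS]splitr.
  set w := Complex _ _ in h1 *; set v' := real_complex _ _ in h2 *.
  rewrite (_ : v' - w = - (S - v') + (S - w)); last by ring.
  by apply: le_trans (le_normcD _ _) _; rewrite normcN; exact: lerD.
move=> n xu a.
pose q := ('I_n * 'I_n * ('I_p * 'I_p))%type.
pose coef (t : q) := a t.1.1 t.2.1 0 * conjc (a t.1.2 t.2.2 0).
have formE (M : T * U -> T * U -> 'M[R[i]]_p) : \sum_(k < n) \sum_(h < n)
   ((a k)^T *m M (xu k) (xu h) *m map_mx (@conjc R) (a h)) 0 0 =
   \sum_(t : q) coef t * M (xu t.1.1) (xu t.1.2) t.2.1 t.2.2.
  rewrite pair_bigA/= -(pair_bigA _ (fun kh lm => coef (kh, lm) *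
    M (xu kh.1) (xu kh.2) lm.1 lm.2))/=; apply: eq_bigr => -[k h] _ /=.
  rewrite quad_formE pair_bigA/=; apply: eq_bigr => -[l m] _ /=.
  by rewrite mulrAC.
rewrite (formE (fun a b => map_mx (real_complex R) (K a b))).
apply: (@normc_ge0_approx _ _ (\sum_t normc (coef t))).
  by apply: sumr_ge0 => t _; exact: normc_ge0.
move=> e e0.
have /choice[N NP] : forall t : q, exists N, forall n, (N <= n)%N -> forall z,
    normc (expansion_sum E phi (fun i => c i (xu t.1.1).2 (xu t.1.2).2 t.2.1 t.2.2) n z -
      real_complex R (K (z.1, (xu t.1.1).2) (z.2, (xu t.1.2).2) t.2.1 t.2.2)) <= e.
  by move=> t; exact: K_exp.
(* One truncation order serves the finitely many entries that occur in the form. *)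
pose M := \max_(t : q) N t.
exists (\sum_(t : q) coef t * entry M (xu t.1.1) (xu t.1.2) t.2.1 t.2.2); last first.
  rewrite -sumrB mulr_suml; apply: le_trans (normc_sum _ _) _; apply: ler_sum => t _.
  rewrite -mulrBr ComplexField.Normc.normcM ler_wpM2l ?normc_ge0//.
  have := NP t M (leq_bigmax _) ((xu t.1.1).1, (xu t.1.2).1).
  by rewrite -normcN opprB mxE /= -!surjective_pairing.
rewrite (_ : \sum_(t : q) _ = \sum_(i <- E M) \sum_(t : q) coef t *
  (phi i (xu t.1.1).1 * conjc (phi i (xu t.1.2).1) *
   c i (xu t.1.1).2 (xu t.1.2).2 t.2.1 t.2.2)); last first.
  rewrite exchange_big/=; apply: eq_bigr => t _; rewrite /entry /expansion_sum mulr_sumr.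
  by apply: eq_bigr => i _ /=; congr (_ * _); rewrite mulrC.
apply: sumr_ge0 => i _.
(* For fixed [i], the values of the harmonic are absorbed into the vectors, which leaves a quadratic
   form of [c i]. *)
have [_ /(_ n (fun k => (xu k).2) (fun k => phi i (xu k).1 *: a k))] := cpd i.
congr (0 <= _); rewrite pair_bigA/= -(pair_bigA _ (fun kh lm => coef (kh, lm) *
  (phi i (xu kh.1).1 * conjc (phi i (xu kh.2).1) *
   c i (xu kh.1).2 (xu kh.2).2 lm.1 lm.2)))/=; apply: eq_bigr => -[k h] _ /=.
rewrite quad_formE pair_bigA/=; apply: eq_bigr => -[l m] _ /=.
by rewrite !mxE /coef rmorphM/=; ring.
Qed.

End positive_definite_kernels.

(** * Continuous functions on the sphere and the surface measure *)

Section borel_rows.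
Context {R : realType} d (T : measurableType d) (n : nat).
Variable h : T -> 'rV[R]_n.
Hypothesis mh : forall i, measurable_fun setT (fun t => h t 0 i).

(** An open set is the union of the rational boxes that it contains. There are countably many, and
    coordinatewise measurability of [h] handles each box. *)
Lemma measurable_preimage_open (U : set 'rV[R]_n) : open U -> measurable (h @^-1` U).
Proof.
move=> oU.
pose box (ab : {ffun 'I_n -> rat} * {ffun 'I_n -> rat}) : set 'rV[R]_n :=
  [set v | forall i, ratr (ab.1 i) < v 0 i < ratr (ab.2 i)].
rewrite (_ : _ @^-1` _ =
    \bigcup_ab (if `[< box ab `<=` U >] then h @^-1` box ab else set0)).
  apply: countable_bigcupT_measurable => //= ab; case: ifP => // _.
  rewrite (_ : _ @^-1` _ = \bigcap_(i in [set: 'I_n])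
      (fun t => h t 0 i) @^-1` `]ratr (ab.1 i), ratr (ab.2 i)[%classic).
    apply: fin_bigcap_measurable => // i _.
    by rewrite -[X in measurable X]setTI; apply: mh.
  apply/seteqP; split => t /= ht i.
    by move=> _ /=; rewrite in_itv/=; exact: ht.
  by have := ht i Logic.I; rewrite /= in_itv.
apply/seteqP; split => t /=; last by move=> [ab _]; case: asboolP => // + ht; exact.
move=> Ut; have /nbhs_ballP[e /= e0 eU] : nbhs (h t) U by exact: open_nbhs_nbhs.
have /choice[a aP] : forall i, exists a : rat, ratr a \in `]h t 0 i - e, h t 0 i[.
  by move=> i; apply: rat_in_itvoo; rewrite gtrBl.
have /choice[b bP] : forall i, exists b : rat, ratr b \in `]h t 0 i, h t 0 i + e[.
  by move=> i; apply: rat_in_itvoo; rewrite ltrDl.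
exists (finfun a, finfun b) => //; case: asboolP => [_ i/=|].
  rewrite !ffunE; have := aP i; have := bP i.
  by rewrite !in_itv/= => /andP[-> _] /andP[_ ->].
case=> v vb; apply: eU; split => // i j; rewrite ord1 /ball/=.
have /= := vb j; have := aP j; have := bP j; rewrite !ffunE !in_itv/=.
move=> /andP[_ b2] /andP[a1 _] /andP[v1 v2].
by rewrite ltr_distlC (lt_trans a1 v1) (lt_trans v2 b2).
Qed.

(** The restriction to an open [D] admits extensions constant along rays, which are continuous only
    away from the origin. *)
Lemma measurable_fun_continuous_comp (D : set 'rV[R]_n) (f : 'rV[R]_n -> R) :
  open D -> (forall y, D y -> {for y, continuous f}) -> (forall t, D (h t)) ->
  measurable_fun setT (f \o h).
Proof.
move=> oD cf hD; apply: (measurability _ (RGenOInfty.measurableE R)) => //.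
move=> _ [_ [a ->] <-]; rewrite setTI.
rewrite (_ : _ @^-1` _ = h @^-1` (D `&` f @^-1` `]a, +oo[%classic)).
  apply: measurable_preimage_open; rewrite openE => y [Dy fy].
  apply: filterI; first by exact: open_nbhs_nbhs.
  by apply: (cf _ Dy); apply: open_nbhs_nbhs; split => //; exact: interval_open.
by apply/seteqP; split => t /=; [split|case].
Qed.

End borel_rows.

Section squared_norm.
Context {R : realType} {n : nat}.
Implicit Types y : 'rV[R]_n.

(** The squared Euclidean norm is smooth everywhere, unlike [enorm]; the norm of the normed space of
    rows is the maximum norm. *)
Definition sqnorm y : R := \sum_i y 0 i ^+ 2.

Lemma sqnorm_ge0 y : 0 <= sqnorm y.
Proof. by apply: sumr_ge0 => i _; exact: sqr_ge0. Qed.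

Lemma sqr_enorm y : enorm y ^+ 2 = sqnorm y.
Proof. by rewrite /enorm sqr_sqrtr// sqnorm_ge0. Qed.

Lemma sqnorm_eq0 y : (sqnorm y == 0) = (y == 0).
Proof.
apply/eqP/eqP => [y0|->]; last by rewrite /sqnorm big1// => i _; rewrite mxE expr0n.
apply/rowP => i; rewrite mxE; apply/eqP; rewrite -sqrf_eq0; apply/eqP.
by move: i (erefl true); apply: psumr_eq0P => // i _; exact: sqr_ge0.
Qed.

Lemma sqnorm0 : sqnorm 0 = 0.
Proof. by apply/eqP; rewrite sqnorm_eq0. Qed.

Lemma sqnorm_gt0 y : (0 < sqnorm y) = (y != 0).
Proof. by rewrite lt_def sqnorm_ge0 andbT sqnorm_eq0. Qed.

Lemma enorm_eq1 y : (enorm y == 1) = (sqnorm y == 1).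
Proof. by rewrite -sqr_enorm sqrp_eq1// sqrtr_ge0. Qed.

Lemma enorm_itv y : (0 < enorm y <= 1) = (0 < sqnorm y <= 1).
Proof. by rewrite /enorm -/(sqnorm y) sqrtr_gt0 -[X in _ <= X]sqrtr1 ler_sqrt// ?ler01. Qed.

Lemma coord_sqr_le y i : y 0 i ^+ 2 <= sqnorm y.
Proof.
by rewrite /sqnorm (bigD1 i)//= lerDl sumr_ge0// => j _; exact: sqr_ge0.
Qed.

Lemma continuous_sqnorm : continuous (@sqnorm).
Proof.
apply: (@continuous_big _ _ +%R 0) => [|i _].
  exact: add_continuous.
by move=> y; have c := @coord_continuous R 1 n 0 i y; exact: (cvgM c c).
Qed.

End squared_norm.

Section sphere_functions.
Context {R : realType} {n : nat}.
Implicit Types (f : sphere R n -> R) (x : sphere R n).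

Lemma sphere_neq0 x : (x : 'rV[R]_n.+1) != 0.
Proof. by case: x => y /=; rewrite enorm_eq1 -sqnorm_gt0 => /eqP ->. Qed.

Lemma radial_sphere x : radial (x : 'rV[R]_n.+1) = x.
Proof.
apply/val_inj; rewrite /= radialE; case: x => y /= /eqP ->.
by rewrite oner_eq0 invr1 scale1r.
Qed.

Lemma open_row_neq0 m : open [set y : 'rV[R]_m | y != 0].
Proof.
rewrite (_ : [set _ | _] = Num.norm @^-1` [set r : R | r != 0]).
  by apply: open_comp; [move=> ? _; exact: norm_continuous|exact: open_neq].
by apply/seteqP; split => y /=; rewrite normr_eq0.
Qed.

Lemma coord_sphere_measurable i : measurable_fun setT (fun x : sphere R n => (x : 'rV[R]_n.+1) 0 i).
Proof.
move=> _ B mB; rewrite setTI; apply: sub_sigma_algebra.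
rewrite -bigcup_seq; exists i; first by rewrite /= mem_index_enum.
by exists B => //; rewrite setTI.
Qed.

Lemma sphere_compact : compact (range (@sphere_val R n)).
Proof.
have rangeE : range (@sphere_val R n) = sqnorm @^-1` [set 1].
  apply/seteqP; split => [_ [[y y1] _ <-]|y /= y1].
    by apply/eqP; rewrite -enorm_eq1.
  have y1' : enorm y == 1 by rewrite enorm_eq1 y1.
  by exists (Sphere y1').
apply: bounded_closed_compact; rewrite rangeE.
  exists 1; split; first exact: num_real.
  move=> B B1 y /= y1; apply: le_trans (ltW B1).
  rewrite [leLHS]mx_normrE; apply/bigmax_leP; split => // -[i j] _ /=.
  by rewrite ord1 -(expr_le1 (n := 2))// real_normK ?num_real// -y1 coord_sqr_le.
apply: preimage_closed; last exact: closed_eq.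
by move=> ? ?; exact: continuous_sqnorm.
Qed.

Lemma sphere_continuous_measurable f :
  (forall y, y != 0 -> {for y, continuous (homog0 f)}) -> measurable_fun setT f.
Proof.
move=> cf; rewrite (_ : f = homog0 f \o @sphere_val R n); last first.
  by apply/funext => x; rewrite /= /homog0 radial_sphere.
apply: (measurable_fun_continuous_comp _ (@open_row_neq0 n.+1)) => //.
- exact: coord_sphere_measurable.
- exact: sphere_neq0.
Qed.

Lemma sphere_continuous_bounded f :
  (forall y, y != 0 -> {for y, continuous (homog0 f)}) ->
  exists B, forall x, `|f x| <= B.
Proof.
move=> cf.
have : compact (homog0 f @` range (@sphere_val R n)).
  apply: continuous_compact; last exact: sphere_compact.
  apply: continuous_in_subspaceT => y; rewrite inE => -[x _ <-].
  by apply: cf; exact: sphere_neq0.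
move=> /compact_bounded[B [_ BP]]; exists (B + 1) => x.
apply: BP; first by rewrite ltrDl.
by exists (x : 'rV[R]_n.+1) => //; rewrite /homog0 radial_sphere.
Qed.

End sphere_functions.

(** The nonnegative case is applied to the positive and the negative part; integrability keeps their
    difference well defined. *)
Lemma integral_mscale d (T : measurableType d) (R : realType)
    (mu : {measure set T -> \bar R}) (k : {nonneg R}) (f : T -> \bar R) :
  mu.-integrable setT f ->
  (\int[mscale k mu]_x f x = k%:num%:E * \int[mu]_x f x)%E.
Proof.
move=> intf; have mf := measurable_int _ intf.
have fp := integrable_fin_num measurableT (integrable_funepos measurableT intf).
have fn := integrable_fin_num measurableT (integrable_funeneg measurableT intf).
rewrite [LHS]integralE (integralE mu).
rewrite (ge0_integral_mscale mu measurableT k (measurable_funepos mf))//.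
rewrite (ge0_integral_mscale mu measurableT k (measurable_funeneg mf))//.
move: fp fn; move: (\int[mu]_x f^\+ x)%E (\int[mu]_x f^\- x)%E => a b afin bfin.
by rewrite muleBr// fin_num_adde_defr.
Qed.

Lemma integral_mrestr d (T : measurableType d) (R : realType)
    (mu : {measure set T -> \bar R}) (D : set T) (mD : measurable D) (f : T -> \bar R) :
  (mrestr mu mD).-integrable setT f ->
  (\int[mrestr mu mD]_x f x = \int[mu]_(x in D) f x)%E.
Proof.
move=> intf.
rewrite (negligible_integral (measurableC mD) measurableT intf); last first.
  by rewrite /= /mrestr setICl measure0.
rewrite setDE setCK setTI; apply: eq_measure_integral => A mA AD /=.
by rewrite /mrestr setIidl.
Qed.

(** The surface measure is [n + 1] times the image under [radial] of Lebesgue measure on the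
    punctured ball. Integrals over the sphere thus become integrals of extensions constant along
    rays. *)
Lemma surface_integral (R : realType) n (h : sphere R n -> R) (B : R) :
  measurable_fun setT h -> (forall x, `|h x| <= B) ->
  (\int[surface_measure n]_x (h x)%:E = (n.+1%:R)%:E *
    \int[lebesgue_tuple n.+1]_(t in @punctured_ball R n) (h (radial (row_of_tuple t)))%:E)%E.
Proof.
move=> mh hB.
set nu := mrestr (lebesgue_tuple n.+1) (@measurable_punctured_ball R n).
have int1 : nu.-integrable setT (EFin \o (h \o (radial \o @row_of_tuple R n))).
  apply: measurable_bounded_integrable => //.
  - by rewrite /= /mrestr setTI; exact: lebesgue_punctured_ball.
  - exact: (measurableT_comp mh (@measurable_radial R n)).
  - exists B; split; first exact: num_real.
    by move=> C BC x _; apply: le_trans (hB _) (ltW BC).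
have mh' : measurable_fun setT (EFin \o h) by exact/measurable_EFinP.
pose pf : {measure set (sphere R n) -> \bar R} :=
  measure_function_pushforward__canonical__measure_function_Measure nu
    (@measurable_radial R n).
have int2 : pf.-integrable setT (EFin \o h).
  exact: (integrable_pushforward (@measurable_radial R n) mh' int1 measurableT).
transitivity ((n.+1%:R)%:E * \int[pf]_x (h x)%:E)%E.
  exact: (integral_mscale (n.+1%:R)%:nng int2).
congr (_ * _)%E.
rewrite (integral_pushforward (@measurable_radial R n) mh' int1 measurableT).
exact: (integral_mrestr int1).
Qed.

(** * Integration by parts and differential calculus on rows *)

Section partial_integration.
Context {R : realType}.
Local Notation mR := (measurableTypeR R).

(** As [s] varies this runs through a line parallel to an axis, along which one-variable calculus
    applies. *)
Definition set_coord m (i : 'I_m) (t : m.-tuple mR) (s : R) : m.-tuple mR :=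
  [tuple if j == i then s else tnth t j | j < m].

Lemma set_coord0 m (y : m.-tuple mR) (x s : R) :
  set_coord ord0 (tuple_cons (x, y)) s = tuple_cons (s, y).
Proof.
apply: eq_from_tnth => j; rewrite tnth_mktuple /tuple_cons/=.
case: (unliftP ord0 j) => [k ->|->]; last by rewrite eqxx tnth0.
by rewrite !tnthS eq_sym eq_liftF.
Qed.

Lemma set_coord_lift m (y : m.-tuple mR) (x s : R) (j : 'I_m) :
  set_coord (lift ord0 j) (tuple_cons (x, y)) s = tuple_cons (x, set_coord j y s).
Proof.
apply: eq_from_tnth => k; rewrite tnth_mktuple /tuple_cons/=.
case: (unliftP ord0 k) => [l ->|->]; last by rewrite eq_liftF !tnth0.
by rewrite !tnthS tnth_mktuple (inj_eq lift_inj).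
Qed.

Lemma integral_derive_compact (f F : R -> R) (B : R) :
  continuous f -> (forall x : R, is_derive x 1 F (f x)) ->
  (forall x : R, B < `|x| -> f x = 0 /\ F x = 0) ->
  (\int[lebesgue_measure]_x (f x)%:E = 0)%E.
Proof.
(* The interval [[-b, b]] is nondegenerate and its end points lie where [F] vanishes, whatever the
   sign of [B]. *)
move=> cf dF supp; pose b := `|B| + 1.
have b0 : 0 < b by rewrite ltr_wpDl.
have Bb : B < b by apply: le_lt_trans (ler_norm _) _; rewrite ltrDl.
have fb x : b < `|x| -> f x = 0 by move=> bx; apply: (supp x _).1; exact: lt_trans bx.
transitivity (\int[lebesgue_measure]_(x in `[(- b)%R, b]) (f x)%:E)%E.
  rewrite [RHS]integral_mkcond; apply: eq_integral => x _.
  rewrite patchE; case: ifPn => //; rewrite notin_setE/= in_itv/= -ler_norml.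
  by move=> /negP; rewrite -ltNge => /fb ->.
have cF : continuous F.
  move=> x; apply: differentiable_continuous; apply/derivable1_diffP.
  by case: (dF x).
rewrite (@continuous_FTC2 _ f F)//.
- by rewrite !(supp _ _).2 ?subee// ?normrN gtr0_norm.
- by apply: (lt_trans _ b0); rewrite oppr_lt0.
- exact: continuous_subspaceT.
- split=> [x _||]; first by case: (dF x).
    by apply: cvg_at_right_filter; exact: cF.
  by apply: cvg_at_left_filter; exact: cF.
- by move=> x _; rewrite derive1E; case: (dF x).
Qed.

Lemma lebesgue_tuple_box (B : R) k : exists C : set (k.-tuple mR),
  [/\ measurable C, (lebesgue_tuple k C < +oo)%E &
   forall t : k.-tuple mR, (forall i, `|tnth t i : R| <= B) -> C t].
Proof.
elim: k => [|k [C [mC Coo CP]]].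
  by exists setT; split=> //=; rewrite diracT ltry.
exists (@tuple_uncons _ k @^-1` (`[- B, B]%classic `*` C)); split.
- rewrite -[X in measurable X]setTI; apply: measurable_tuple_uncons => //.
  by apply: measurableX => //; exact: measurable_itv.
- rewrite /= cons_measureE//; apply: lte_mul_pinfty => //.
  rewrite ge0_fin_numE// lebesgue_measure_itv/=.
  by case: ifP => // _; rewrite -EFinB ltry.
- move=> t tP; split => /=; first by rewrite in_itv/= -ler_norml; exact: tP.
  apply: CP => i; apply: le_trans (tP (lift ord0 i)).
  by rewrite [in leRHS](tuple_eta t) tnthS.
Qed.

Lemma lebesgue_tuple_integrable m (f : m.-tuple mR -> R) (B C : R) :
  measurable_fun setT f -> (forall t, `|f t| <= C) ->
  (forall (t : m.-tuple mR) (j : 'I_m), B < `|tnth t j : R| -> f t = 0) ->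
  (lebesgue_tuple m).-integrable setT (EFin \o f).
Proof.
move=> mf fC supp; have [D [mD Doo DP]] := lebesgue_tuple_box B m.
rewrite (_ : EFin \o f = (EFin \o f) \_ D).
  apply/(integrable_mkcond _ mD).
  apply: measurable_bounded_integrable => //; first exact: measurable_funTS.
  exists C; split; first exact: num_real.
  by move=> M CM x _; apply: le_trans (fC x) (ltW CM).
apply/funext => t; rewrite patchE; case: ifPn => //; rewrite notin_setE => nD /=.
have [j Bj] : exists j, B < `|tnth t j : R|.
  apply: contrapT => h; apply: nD; apply: DP => i; rewrite leNgt; apply/negP => ?.
  by apply: h; exists i.
by rewrite (supp t j).
Qed.

(** Induction on the dimension through Fubini. If [i] is the first coordinate, it is integrated
    innermost by the fundamental theorem of calculus; otherwise the first coordinate is frozen and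
    the induction hypothesis applies to the others. *)
Lemma integral_partial_compact m (i : 'I_m) (W W' : m.-tuple mR -> R) (B C : R) :
  measurable_fun setT W' -> (forall t, `|W' t| <= C) ->
  (forall (t : m.-tuple mR) (j : 'I_m), B < `|tnth t j : R| -> W' t = 0 /\ W t = 0) ->
  (forall t (s : R), is_derive s 1 (fun s => W (set_coord i t s)) (W' (set_coord i t s))) ->
  (forall t, continuous (fun s : R => W' (set_coord i t s))) ->
  (\int[lebesgue_tuple m]_t (W' t)%:E = 0)%E.
Proof.
elim: m i W W' => [[]//|m ih] i W W' mW' W'C supp dW cW'.
have intW' : (lebesgue_tuple m.+1).-integrable setT (EFin \o W').
  by apply: (lebesgue_tuple_integrable mW' W'C) => t j /supp[].
have intc : (lebesgue_measure \x lebesgue_tuple m)%E.-integrable setT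
    (EFin \o (W' \o @tuple_cons R m)).
  apply/integrableP; split.
    by apply/measurable_EFinP; apply: measurableT_comp => //; exact: measurable_tuple_cons.
  have /integrableP[_] := intW'; apply: le_lt_trans.
  rewrite [leRHS](ge0_integral_pushforward (@measurable_tuple_cons R m)
    (lebesgue_measure \x lebesgue_tuple m)%E measurableT)//.
  by apply: measurableT_comp => //; exact/measurable_EFinP.
transitivity (\int[(lebesgue_measure \x lebesgue_tuple m)%E]_z (W' (tuple_cons z))%:E)%E.
  have mEW' : measurable_fun setT (EFin \o W') by exact/measurable_EFinP.
  exact: (integral_pushforward (@measurable_tuple_cons R m) mEW' intc measurableT).
case: (unliftP ord0 i) => [j|] ij; subst i.
  rewrite -(integral12_prod_meas1 intc) /fubini_F.
  rewrite integral0_eq// => x _ /=.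
  apply: (ih j (fun y => W (tuple_cons (x, y))) (fun y => W' (tuple_cons (x, y)))).
  - apply: measurableT_comp => //.
    exact: (measurableT_comp (@measurable_tuple_cons R m) (pair1_measurable x)).
  - by move=> t; exact: W'C.
  - by move=> t k; have := supp (tuple_cons (x, t)) (lift ord0 k); rewrite tnthS.
  - move=> t s; have := dW (tuple_cons (x, t)) s.
    by rewrite set_coord_lift; under eq_fun do rewrite set_coord_lift.
  - by move=> t; have := cW' (tuple_cons (x, t)); under eq_fun do rewrite set_coord_lift.
rewrite -(integral21_prod_meas1 intc) /fubini_G.
rewrite integral0_eq// => y _ /=.
apply: (@integral_derive_compact _ (fun s => W (tuple_cons (s, y))) B).
- by have := cW' (tuple_cons (0, y)); under eq_fun do rewrite set_coord0.
- move=> s; have := dW (tuple_cons (0, y)) s.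
  by rewrite set_coord0; under eq_fun do rewrite set_coord0.
- by move=> s Bs; apply: (supp _ ord0); rewrite tnth0.
Qed.

End partial_integration.

Section directional_derivatives.
Context {R : realType}.

(** Both sides have the same difference quotient. *)
Lemma is_derive_line (V : normedModType R) (G : V -> R) (a v : V) (s d : R) :
  is_derive (a + s *: v) v G d <-> is_derive s 1 (fun t : R => G (a + t *: v)) d.
Proof.
have e : (fun h => h^-1 *: ((G \o shift (a + s *: v)) (h *: v) - G (a + s *: v))) =
    (fun h : R => h^-1 *: (((fun t : R => G (a + t *: v)) \o shift s) (h *: 1)
      - G (a + s *: v))).
  apply/funext => h /=; congr (_ *: (G _ - _)).
  by rewrite addrCA -scalerDl; congr (_ + _ *: _); rewrite /GRing.scale/= mulr1.
by split=> -[]; rewrite /derivable/derive ?e => h1 h2; constructor;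
  rewrite /derivable/derive ?e// -?e.
Qed.

(** The mean value theorem between 0 and an [a] of either sign, as the increments [h * v 0 k] below
    may be negative. *)
Lemma MVT_from0 (f f' : R -> R) (a : R) :
  (forall s : R, `|s| <= `|a| -> is_derive s 1 f (f' s)) ->
  exists2 s, `|s| <= `|a| & f a - f 0 = f' s * a.
Proof.
move=> df.
have cf s : `|s| <= `|a| -> {for s, continuous f}.
  by move=> sa; apply: differentiable_continuous; apply/derivable1_diffP; case: (df s sa).
have [a0|a0] := leP 0 a.
  have [||s] := @MVT_segment R f f' 0 a a0.
  - move=> s; rewrite in_itv/= => /andP[s0 sa]; apply: df.
    by rewrite !ger0_norm// ltW.
  - apply: continuous_in_subspaceT => s; rewrite inE/= in_itv/= => /andP[s0 sa].
    by apply: cf; rewrite !ger0_norm.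
  - rewrite in_itv/= => /andP[s0 sa]; rewrite subr0 => e.
    by exists s; rewrite // !ger0_norm.
have [||s] := @MVT_segment R f f' a 0 (ltW a0).
- move=> s; rewrite in_itv/= => /andP[s0 sa]; apply: df.
  by rewrite !ltr0_norm// lerN2 ltW.
- apply: continuous_in_subspaceT => s; rewrite inE/= in_itv/= => /andP[s0 sa].
  by apply: cf; rewrite !ler0_norm ?lerN2// ltW.
- rewrite in_itv/= => /andP[s0 sa]; rewrite sub0r => e.
  exists s; first by rewrite !ler0_norm ?lerN2// ltW.
  by rewrite -opprB e mulrN opprK.
Qed.

Lemma coord_le_norm n (v : 'rV[R]_n) i : `|v 0 i| <= `|v|.
Proof.
rewrite [leRHS]mx_normrE; apply/bigmax_geP; right => /=.
by exists (0, i).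
Qed.

Lemma norm_le_coord n (v : 'rV[R]_n) (r : R) :
  0 <= r -> (forall i, `|v 0 i| <= r) -> `|v| <= r.
Proof.
move=> r0 vr; rewrite [leLHS]mx_normrE; apply/bigmax_leP; split => // -[i j] _ /=.
by rewrite ord1.
Qed.

(* Telescope along the coordinates and apply the mean value theorem to each
   increment. *)
Lemma is_derive_partials n (G : 'rV[R]_n -> R) (y v : 'rV[R]_n) :
  (forall i : 'I_n, \forall z \near y, derivable G z (delta_mx 0 i)) ->
  (forall i : 'I_n, {for y, continuous ('D_(delta_mx 0 i) G)}) ->
  is_derive y v G (\sum_i v 0 i * 'D_(delta_mx 0 i) G y).
Proof.
move=> dG cG; set S := \sum_i _.
suff lim : h^-1 *: ((G \o shift y) (h *: v) - G y) @[h --> 0^'] --> S.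
  constructor; first by apply/cvg_ex; exists S.
  exact: (cvg_lim (@Rhausdorff R) lim).
apply/cvgrPdist_le => e e0.
have den0 : 0 < \sum_i `|v 0 i| + 1 by rewrite ltr_wpDl// sumr_ge0.
(* The errors of the increments add up to at most [e'] times the sum of the [|v 0 i|], which is at
   most [e]. *)
pose e' := e / (\sum_i `|v 0 i| + 1).
have e'0 : 0 < e' by rewrite divr_gt0.
have : \forall z \near y, forall i : 'I_n, derivable G z (delta_mx 0 i) /\
    `|'D_(delta_mx 0 i) G y - 'D_(delta_mx 0 i) G z| <= e'.
  apply: (@filter_forall _ _ (fun i z => derivable G z (delta_mx 0 i) /\
    `|'D_(delta_mx 0 i) G y - 'D_(delta_mx 0 i) G z| <= e') (nbhs y)) => i.
  apply: filterI; first exact: dG.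
  by have /cvgrPdist_le := cG i; apply.
move=> /nbhs_ballP[del /= del0 delP].
have v10 : 0 < `|v| + 1 by rewrite ltr_wpDl.
near=> h.
have h0 : h != 0 by near: h; exact: nbhs_dnbhs_neq.
have hv : `|h| * `|v| < del.
  have : `|h| < del / (`|v| + 1).
    by near: h; apply: dnbhs0_lt; rewrite divr_gt0.
  rewrite ltr_pdivlMr// => h1; apply: le_lt_trans h1.
  by rewrite ler_wpM2l// lerDl.
(* Truncating [v] to its first [k] coordinates gives a path from [y] to [y + h *: v] whose steps are
   parallel to the axes. *)
pose vk (k : nat) : 'rV[R]_n := \row_i (if (i < k)%N then v 0 i else 0).
pose z k := y + h *: vk k.
have zE (k : 'I_n) : z k.+1 = z k + (h * v 0 k) *: delta_mx 0 k.
  rewrite /z -addrA; congr (_ + _); apply/rowP => j; rewrite !mxE ltnS leq_eqVlt eqxx/=.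
  have [jk|jk] := eqVneq (j : nat) k; last first.
    by rewrite -val_eqE/= (negPf jk) mulr0 addr0.
  by rewrite (val_inj jk) eqxx ltnn mulr0 add0r mulr1.
have step (k : 'I_n) : exists2 xi, `|'D_(delta_mx 0 k) G y - xi| <= e' &
    G (z k.+1) - G (z k) = xi * (h * v 0 k).
  have near_y s : `|s| <= `|h * v 0 k| -> ball y del (z k + s *: delta_mx 0 k).
    move=> sk; rewrite -ball_normE /ball_/=; apply: le_lt_trans hv.
    rewrite distrC; apply: norm_le_coord => [|i]; first by rewrite mulr_ge0.
    rewrite /z -[y + _ + _]addrA addrAC subrr add0r !mxE.
    rewrite eqxx/=; have [ik|ik] := ltnP i k.
      rewrite (_ : i == k = false) ?mulr0 ?addr0; last by apply/negbTE; rewrite neq_ltn ik.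
      by rewrite normrM ler_wpM2l// coord_le_norm.
    rewrite mulr0 add0r; have [_|_] := eqVneq i k; last by rewrite mulr0 normr0 mulr_ge0.
    by rewrite mulr1 (le_trans sk)// normrM ler_wpM2l// coord_le_norm.
  have [s sk e1] := @MVT_from0 (fun s => G (z k + s *: delta_mx 0 k))
    (fun s => 'D_(delta_mx 0 k) G (z k + s *: delta_mx 0 k)) (h * v 0 k)
    (fun s sk => (is_derive_line _ _ _ _ _).1
       (derivableP ((delP _ (near_y s sk)) k).1)).
  exists ('D_(delta_mx 0 k) G (z k + s *: delta_mx 0 k)).
    by have [] := delP _ (near_y s sk) k.
  by rewrite zE -e1 scale0r addr0.
have /choice[xi xiP] : forall k : 'I_n, exists xi,
    `|'D_(delta_mx 0 k) G y - xi| <= e' /\ G (z k.+1) - G (z k) = xi * (h * v 0 k).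
  by move=> k; have [xi ? ?] := step k; exists xi.
have GzE : G (h *: v + y) - G y = \sum_(k < n) xi k * (h * v 0 k).
  rewrite -(eq_bigr _ (fun k _ => (xiP k).2)) -(big_mkord xpredT (fun k => G (z k.+1) - G (z k))).
  rewrite telescope_sumr//; congr (G _ - G _).
    rewrite addrC /z; congr (_ + _ *: _); apply/rowP => j.
    by rewrite mxE ltn_ord.
  rewrite /z (_ : vk 0%N = 0) ?scaler0 ?addr0//.
  by apply/rowP => j; rewrite !mxE.
rewrite /= GzE scaler_sumr /S -sumrB.
apply: (@le_trans _ _ (\sum_(i < n) `|v 0 i| * e')).
  apply: le_trans (ler_norm_sum _ _ _) _; apply: ler_sum => k _.
  rewrite (_ : _ - _ = v 0 k * ('D_(delta_mx 0 k) G y - xi k)).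
    by rewrite normrM ler_wpM2l//; exact: (xiP k).1.
  have -> : h^-1 *: (xi k * (h * v 0 k)) = v 0 k * xi k by rewrite /GRing.scale/=; field.
  by rewrite mulrBr.
rewrite -mulr_suml /e' mulrCA ler_piMr ?(ltW e0)// ler_pdivrMr// mul1r lerDl//.
Unshelve. all: by end_near. Qed.

End directional_derivatives.

Section homogeneous_derivatives.
Context {R : realType} {V : normedModType R}.

(** Near [t = 0], [G (r y + t v) = c G (y + (t / r) v)], and the chain rule gives the factor
    [1 / r]. With [c = 1] this scales first derivatives of a function constant along rays, with
    [c = 1 / r] second ones. *)
Lemma is_derive_homogeneous (G : V -> R) (r c : R) (y v : V) :
  r != 0 -> (\forall z \near y, G (r *: z) = c * G z) -> derivable G y v ->
  is_derive (r *: y) v G (c * r^-1 * 'D_v G y).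
Proof.
move=> r0 hG dG.
have := is_derive_line G (r *: y) v 0 (c * r^-1 * 'D_v G y).
rewrite scale0r addr0 => ->.
pose phi (t : R) := c * G (y + (t / r) *: v).
apply: (@near_eq_is_derive _ _ _ phi).
  have cl : (fun t : R => y + (t / r) *: v) @ (0 : R) --> y.
    rewrite -[X in _ --> X]addr0 -(scale0r v) -[X in X *: v](mul0r r^-1).
    apply: cvgD; first exact: cvg_cst.
    by apply: cvgZl; apply: cvgMl; exact: cvg_id.
  near=> t; rewrite /phi.
  have <- : G (r *: (y + (t / r) *: v)) = c * G (y + (t / r) *: v).
    by near: t; exact: (cl _ hG).
  by rewrite scalerDr scalerA mulrC divfK.
have d1 : is_derive (0 / r : R) 1 (fun t : R => G (y + t *: v)) ('D_v G y).
  by apply: (is_derive_line G y v (0 / r) _).1; rewrite mul0r scale0r addr0; exact: derivableP.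
have d2 : is_derive (0 : R) 1 (fun t : R => t / r) r^-1.
  have := @is_deriveM R _ (@id R) (cst r^-1) 0 1 1 0 (is_derive_id _ _) (is_derive_cst _ _ _).
  by rewrite scaler0 add0r /GRing.scale/= mulr1.
have d3 := @is_derive1_comp _ (fun t : R => G (y + t *: v)) (fun t : R => t / r) 0 _ _ d1 d2.
have : is_derive (0 : R) (1 : R) (c \*: ((fun t : R => G (y + t *: v)) \o (fun t : R => t / r)))
    (c *: ('D_v G y / r)) by exact: is_deriveZ.
by rewrite {2}/GRing.scale/= (mulrC ('D_v G y)) mulrA.
Unshelve. all: by end_near. Qed.

End homogeneous_derivatives.

(** * Continuously differentiable cutoff functions *)

Section C1_functions.
Context {R : realType}.
Implicit Types f g : R -> R.

Definition C1 f : Prop :=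
  exists2 f' : R -> R, (forall x : R, is_derive x 1 f (f' x)) & continuous f'.

Lemma C1_continuous f : C1 f -> continuous f.
Proof.
move=> [f' df _] x; apply: differentiable_continuous; apply/derivable1_diffP.
by case: (df x).
Qed.

Lemma C1M f g : C1 f -> C1 g -> C1 (fun x => f x * g x).
Proof.
move=> Cf Cg; have [f' df cf'] := Cf; have [g' dg cg'] := Cg.
exists (fun x => f x * g' x + g x * f' x).
  by move=> x; exact: is_deriveM.
move=> x; apply: cvgD; apply: cvgM; [exact: C1_continuous|exact: cg'|exact: C1_continuous|exact: cf'].
Qed.

Lemma C1D f g : C1 f -> C1 g -> C1 (fun x => f x + g x).
Proof.
move=> [f' df cf'] [g' dg cg']; exists (fun x => f' x + g' x).
  by move=> x; exact: is_deriveD.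
by move=> x; apply: cvgD; [exact: cf'|exact: cg'].
Qed.

Lemma C1V f : (forall x, f x != 0) -> C1 f -> C1 (fun x => (f x)^-1).
Proof.
move=> f0 Cf; have [f' df cf'] := Cf.
exists (fun x => - (f x) ^- 2 * f' x).
  move=> x; have [d1 d2] := df x; constructor; first exact: derivableV.
  by rewrite deriveV// d2.
move=> x; apply: cvgM; last exact: cf'.
apply: cvgN; apply: cvgV; first by rewrite expf_neq0.
by apply: cvgM; exact: C1_continuous.
Qed.

Lemma C1_affine f (a b : R) : C1 f -> C1 (fun x => f (a * x + b)).
Proof.
move=> [f' df cf']; exists (fun x => f' (a * x + b) * a).
  move=> x; apply: (@is_derive1_comp _ f (fun x => a * x + b)).
  have d1 : is_derive (x : R) (1 : R) (a \*: @id R) (a *: 1) by exact: is_deriveZ.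
  have := is_deriveD d1 (is_derive_cst b x 1).
  by rewrite addr0 [a *: 1]mulr1.
move=> x; apply: cvgM; last exact: cvg_cst.
apply: (@continuous_comp _ _ _ (fun x => a * x + b) f'); last exact: cf'.
by apply: cvgD; [apply: cvgM; [exact: cvg_cst|exact: cvg_id]|exact: cvg_cst].
Qed.

Lemma C1_id : C1 id.
Proof. by exists (fun=> 1); [move=> x; exact: is_derive_id|move=> x; exact: cvg_cst]. Qed.

(** The maximum of [x] and 0, in a form that shows its continuity. *)
Definition pos_part (x : R) : R := (x + `|x|) / 2.

Lemma pos_partE x : 0 <= x -> pos_part x = x.
Proof. by move=> x0; rewrite /pos_part ger0_norm//; lra. Qed.

Lemma pos_part_le0 x : x <= 0 -> pos_part x = 0.
Proof. by move=> x0; rewrite /pos_part ler0_norm// subrr mul0r. Qed.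

Lemma continuous_pos_part : continuous pos_part.
Proof.
move=> x; apply: cvgM; last exact: cvg_cst.
by apply: cvgD; [exact: cvg_id|exact: norm_continuous].
Qed.

Lemma C1_sqr_pos_part : C1 (fun x => pos_part x ^+ 2).
Proof.
exists (fun x => 2 * pos_part x); last first.
  by move=> x; apply: cvgM; [exact: cvg_cst|exact: continuous_pos_part].
move=> x; have [x0|x0|->] := ltgtP x 0.
- rewrite pos_part_le0 ?ltW// mulr0.
  apply: (@near_eq_is_derive _ _ _ (cst 0)).
  near=> z; rewrite pos_part_le0 ?expr0n//.
  by apply: ltW; near: z; exact: lt_nbhsl.
- rewrite pos_partE ?ltW//.
  apply: (@near_eq_is_derive R R R (fun x : R => x ^+ 2)).
    near=> z; rewrite pos_partE//.
    by apply: ltW; near: z; exact: lt_nbhsr.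
  have := @is_deriveX R _ (@id R) 2 x 1 1 (is_derive_id _ _).
  by rewrite expr1 /GRing.scale/= mulr1.
(* At 0 the difference quotient of the squared positive part is the positive part itself, which is
   continuous. *)
- apply/is_derive1_caratheodory; exists pos_part; split.
  + move=> z; rewrite (pos_part_le0 (lexx 0)) expr0n subr0 subr0.
    have [z0|z0] := leP 0 z; first by rewrite pos_partE.
    by rewrite pos_part_le0 ?ltW// expr0n mul0r.
  + exact: continuous_pos_part.
  + by rewrite (pos_part_le0 (lexx 0)) mulr0.
Unshelve. all: by end_near. Qed.

(** A step from 0 on [x <= 0] to 1 on [x >= 1]. The denominator never vanishes, since [x] or [1 - x]
    is positive. *)
Definition smooth_step (x : R) : R :=
  pos_part x ^+ 2 / (pos_part x ^+ 2 + pos_part (1 - x) ^+ 2).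

Let smooth_step_den x : 0 < pos_part x ^+ 2 + pos_part (1 - x) ^+ 2.
Proof.
have [x0|x0] := leP x 0.
  by rewrite ltr_wpDl ?sqr_ge0// exprn_gt0// pos_partE; lra.
by rewrite ltr_pwDl ?sqr_ge0// exprn_gt0// pos_partE// ltW.
Qed.

Lemma C1_smooth_step : C1 smooth_step.
Proof.
apply: C1M; first exact: C1_sqr_pos_part.
apply: C1V => [x|]; first by rewrite gt_eqF// smooth_step_den.
apply: C1D; first exact: C1_sqr_pos_part.
have := C1_affine (-1) 1 C1_sqr_pos_part.
by under eq_fun do rewrite mulN1r addrC.
Qed.

Lemma smooth_step_ge0 x : 0 <= smooth_step x.
Proof. by rewrite divr_ge0 ?sqr_ge0// ltW// smooth_step_den. Qed.

Lemma smooth_step_le1 x : smooth_step x <= 1.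
Proof. by rewrite ler_pdivrMr ?smooth_step_den// mul1r lerDl sqr_ge0. Qed.

Lemma smooth_step0 x : x <= 0 -> smooth_step x = 0.
Proof. by move=> x0; rewrite /smooth_step pos_part_le0// expr0n mul0r. Qed.

Lemma smooth_step1 x : 1 <= x -> smooth_step x = 1.
Proof.
move=> x1; rewrite /smooth_step (@pos_part_le0 (1 - x)) ?subr_le0// expr0n addr0.
by rewrite divff// sqrf_eq0 pos_partE ?(le_trans ler01)// gt_eqF// (lt_le_trans ltr01).
Qed.

(* Rises from 0 to 1 on [1/(k+1), 2/(k+1)] and falls back on [1, (k+2)/(k+1)] *)
Definition cutoff (k : nat) (s : R) : R :=
  smooth_step (k.+1%:R * s - 1) * smooth_step (k.+2%:R - k.+1%:R * s).

Lemma C1_cutoff k : C1 (cutoff k).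
Proof.
apply: C1M; first exact: C1_affine C1_smooth_step.
have := C1_affine (- k.+1%:R) k.+2%:R C1_smooth_step.
by under eq_fun do rewrite mulNr addrC.
Qed.

Lemma cutoff_ge0 k s : 0 <= cutoff k s.
Proof. by rewrite mulr_ge0// smooth_step_ge0. Qed.

Lemma cutoff_le1 k s : cutoff k s <= 1.
Proof. by rewrite mulr_ile1// ?smooth_step_ge0 ?smooth_step_le1. Qed.

Lemma cutoff_left k s : s <= k.+1%:R^-1 -> cutoff k s = 0.
Proof.
move=> sk; rewrite /cutoff smooth_step0 ?mul0r// subr_le0.
by rewrite -ler_pdivlMl// mulr1.
Qed.

Lemma cutoff_right k s : 2 <= s -> cutoff k s = 0.
Proof.
move=> s2; rewrite /cutoff [X in _ * X]smooth_step0 ?mulr0// subr_le0.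
apply: (@le_trans _ _ (k.+1%:R * 2)); last by rewrite ler_wpM2l.
by rewrite -natrM ler_nat muln2 -addnn addSn addnS ltnS ltnS leq_addr.
Qed.

(** For each [s] the sequence is eventually constant. The value at [s = 1] stays 1 because the
    descent only begins there. *)
Lemma cutoff_cvg s : cutoff k s @[k --> \oo] --> (((0 < s <= 1)%R : bool)%:R : R).
Proof.
have ev (P : nat -> Prop) N : (forall k, (N <= k)%N -> P k) -> \forall k \near \oo, P k.
  by move=> h; exists N.
have [s0|s0] := leP s 0; rewrite /=.
  apply: cvg_near_cst; apply: nearW => k.
  by rewrite cutoff_left// (le_trans s0).
have ub r : 0 < r -> exists N, forall k, (N <= k)%N -> 2 <= k.+1%:R * (r : R).
  move=> r0; exists (Num.truncn (2 / r)) => k Nk.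
  rewrite -ler_pdivrMr//; apply: le_trans (ltW (truncnS_gt _)) _.
  by rewrite ler_nat ltnS.
have [s1|s1] := leP s 1.
  have [N NP] := ub s s0.
  apply: cvg_near_cst; apply: (ev _ N) => k /NP sk.
  have ks : k.+1%:R * s <= k.+1%:R by rewrite ler_piMr.
  by rewrite /cutoff !smooth_step1 ?mulr1// ?[k.+2%:R]mulrS; lra.
have [N NP] := ub (s - 1) (ltac:(by rewrite subr_gt0)).
apply: cvg_near_cst; apply: (ev _ N) => k /NP sk.
rewrite /cutoff [X in _ * X]smooth_step0 ?mulr0//.
by move: sk; rewrite [k.+2%:R]mulrS mulrBr mulr1; lra.
Qed.

End C1_functions.

(** * Orthogonality of eigenfunctions of the Laplace-Beltrami operator *)

Section sphere_laplacian.
Context {R : realType} {n : nat}.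
Implicit Types (f g : sphere R n -> R) (y : 'rV[R]_n.+1).

Lemma near_neq0 y : y != 0 -> \forall z \near y, z != 0.
Proof. by move=> y0; apply: open_nbhs_nbhs; split => //; exact: open_row_neq0. Qed.

Lemma enorm_gt0 y : y != 0 -> 0 < enorm y.
Proof.
rewrite -sqnorm_gt0 -sqr_enorm => y0; rewrite lt_def sqrtr_ge0 andbT.
by apply: contraTneq y0 => ->; rewrite expr0n ltxx.
Qed.

Lemma radialZ (r : R) y : 0 < r -> radial (r *: y) = radial y.
Proof.
move=> r0; apply/val_inj; rewrite /= !radialE enormZ gtr0_norm//.
rewrite mulf_eq0 gt_eqF//=; case: ifPn => // y0.
by rewrite invfM scalerA mulrAC mulVf ?gt_eqF// mul1r.
Qed.

Lemma homog0Z f (r : R) y : 0 < r -> homog0 f (r *: y) = homog0 f y.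
Proof. by move=> r0; rewrite /homog0 radialZ. Qed.

Lemma enorm_radial y : y != 0 -> enorm y *: (radial y : 'rV[R]_n.+1) = y.
Proof.
move=> y0; have e0 := enorm_gt0 y0.
by rewrite radialE gt_eqF// scalerA divff ?gt_eqF// scale1r.
Qed.

(* Euler's identity for functions homogeneous of degree [0] *)
Lemma sum_partial_homog0 f y : sphere_C2 f -> y != 0 ->
  \sum_i y 0 i * partial i (homog0 f) y = 0.
Proof.
move=> Cf y0.
(* The derivative at [y] in the direction [y] is computed twice: from the partial derivatives, and
   as 0 from constancy along the ray. *)
have d1 : is_derive y y (homog0 f) (\sum_i y 0 i * partial i (homog0 f) y).
  apply: is_derive_partials => i.
    near=> z; have z0 : z != 0 by near: z; exact: near_neq0.
    by have [_ /(_ i)[]] := Cf z z0.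
  by have [_ /(_ i)[]] := Cf y y0.
have d0 : is_derive y y (homog0 f) 0.
  have := is_derive_line (homog0 f) y y 0 0.
  rewrite scale0r addr0 => ->.
  apply: (@near_eq_is_derive R R R (cst (homog0 f y))).
  have t1 : \forall t \near (0 : R), -1 < t by apply: lt_nbhsr; rewrite oppr_lt0.
  apply: filterS t1 => t t1.
  by rewrite /= -[X in _ = homog0 f (X + _)]scale1r -scalerDl homog0Z//; lra.
by rewrite -(@derive_val _ _ _ _ _ _ _ d1) (@derive_val _ _ _ _ _ _ _ d0).
Unshelve. all: by end_near. Qed.

Lemma partial_homog0Z f (r : R) y i : sphere_C2 f -> y != 0 -> 0 < r ->
  partial i (homog0 f) (r *: y) = r^-1 * partial i (homog0 f) y.
Proof.
move=> Cf y0 r0; have [_ /(_ i)[dy _ _]] := Cf y y0.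
have hz : \forall z \near y, homog0 f (r *: z) = 1 * homog0 f z.
  by apply: (@nearW _ (nbhs y)) => z; rewrite homog0Z// mul1r.
have d := is_derive_homogeneous (lt0r_neq0 r0) hz dy.
by rewrite [LHS](@derive_val _ _ _ _ _ _ _ d) mul1r.
Qed.

Lemma partial2_homog0Z f (r : R) y i j : sphere_C2 f -> y != 0 -> 0 < r ->
  partial j (partial i (homog0 f)) (r *: y) =
  r^-1 ^+ 2 * partial j (partial i (homog0 f)) y.
Proof.
move=> Cf y0 r0; have [_ /(_ i)[_ _ /(_ j)[dy _]]] := Cf y y0.
have hz : \forall z \near y, partial i (homog0 f) (r *: z) = r^-1 * partial i (homog0 f) z.
  by move: (near_neq0 y0); apply: (@filterS _ (nbhs y)) => z z0; exact: partial_homog0Z.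
have d := is_derive_homogeneous (lt0r_neq0 r0) hz dy.
by rewrite [LHS](@derive_val _ _ _ _ _ _ _ d) expr2.
Qed.

(** The eigenvalue equation is given on the unit sphere. Second derivatives of the extension are
    homogeneous of degree -2, which carries it to all [y != 0]. *)
Lemma laplacian_eigen f (lam : R) y : sphere_C2 f ->
  (forall x, laplace_beltrami f x = - lam * f x) -> y != 0 ->
  \sum_i partial i (partial i (homog0 f)) y = - lam * (sqnorm y)^-1 * homog0 f y.
Proof.
move=> Cf ef y0; have e0 := enorm_gt0 y0.
rewrite -[in LHS](enorm_radial y0).
under eq_bigr do rewrite partial2_homog0Z ?sphere_neq0//.
rewrite -mulr_sumr [X in _ * X](ef (radial y)) /homog0 -sqr_enorm -exprVn.
by rewrite mulrA [_ * - lam]mulrC.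
Qed.

End sphere_laplacian.

Section cut_functions.
Context {R : realType} {n : nat}.
Variables (c : R -> R) (a : R).
Hypotheses (a0 : 0 < a) (c0 : forall s, s < a -> c s = 0).

Lemma near0_sqnorm_lt : \forall z \near (0 : 'rV[R]_n), sqnorm z < a.
Proof.
have h : {for (0 : 'rV[R]_n), continuous sqnorm} by exact: continuous_sqnorm.
have h2 := @cvgr_lt R _ (nbhs (0 : 'rV[R]_n)) _ sqnorm (sqnorm 0) h a.
by apply: h2; rewrite sqnorm0.
Qed.

(** Since [c] vanishes on values below [a > 0], the product is zero near the origin, where [H] may
    be irregular. *)
Lemma continuous_cut (H : 'rV[R]_n -> R) : continuous c ->
  (forall y, y != 0 -> {for y, continuous H}) ->
  continuous (fun y => c (sqnorm y) * H y).
Proof.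
move=> cc cH y; have [->|y0] := eqVneq y 0.
  apply: (@cvg_near_cst _ _ _ _ (nbhs (0 : 'rV[R]_n))).
  move: near0_sqnorm_lt; apply: (@filterS _ (nbhs (0 : 'rV[R]_n))) => z za.
  by rewrite !c0 ?mul0r ?sqnorm0.
have c1 : {for y, continuous (c \o @sqnorm R n)}.
  by apply: continuous_comp; [exact: continuous_sqnorm|exact: cc].
exact: (cvgM c1 (cH y y0)).
Qed.

Lemma is_derive_sqnorm (y : 'rV[R]_n) i : is_derive y (delta_mx 0 i) sqnorm (2 * y 0 i).
Proof.
have := is_derive_line (@sqnorm R n) y (delta_mx 0 i) 0 (2 * y 0 i).
rewrite scale0r addr0 => ->.
(* Moving the coordinate [i] by [s] changes the squared norm by [s * (2 * y 0 i + s)]. *)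
apply/is_derive1_caratheodory; exists (fun s => 2 * y 0 i + s); split.
- move=> s; rewrite scale0r addr0 subr0 /sqnorm (bigD1 i)//= [in X in _ - X](bigD1 i)//=.
  rewrite [X in _ + X - _](eq_bigr (fun j => y 0 j ^+ 2)); last first.
    by move=> j ji; rewrite !mxE (negPf ji) andbF mulr0 addr0.
  by rewrite !mxE !eqxx/=; ring.
- by apply: cvgD; [exact: cvg_cst|exact: cvg_id].
- by rewrite addr0.
Qed.

Lemma is_derive_cut (c' : R -> R) (H : 'rV[R]_n -> R) (H' : R) (y : 'rV[R]_n) i :
  (forall s : R, is_derive s 1 c (c' s)) -> (forall s, s < a -> c' s = 0) ->
  (y != 0 -> is_derive y (delta_mx 0 i) H H') ->
  is_derive y (delta_mx 0 i) (fun y => c (sqnorm y) * H y)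
    (c' (sqnorm y) * (2 * y 0 i * H y) + c (sqnorm y) * H').
Proof.
move=> dc c'0 dH; have [->|y0] := eqVneq y 0.
  rewrite sqnorm0 c'0// c0// !mul0r addr0.
  apply: (@near_eq_is_derive R _ _ (cst 0)).
  move: near0_sqnorm_lt; apply: (@filterS _ (nbhs (0 : 'rV[R]_n))) => z za.
  by rewrite c0 ?mul0r.
have dS : is_derive y (delta_mx 0 i) (fun y => c (sqnorm y)) (c' (sqnorm y) * (2 * y 0 i)).
  have := is_derive_line (fun y => c (sqnorm y)) y (delta_mx 0 i) 0 (c' (sqnorm y) * (2 * y 0 i)).
  rewrite scale0r addr0 => ->.
  apply: (@is_derive1_comp _ c (fun t => sqnorm (y + t *: delta_mx 0 i))).
    by rewrite scale0r addr0; exact: dc.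
  have := is_derive_line (@sqnorm R n) y (delta_mx 0 i) 0 (2 * y 0 i).
  by rewrite scale0r addr0 => <-; exact: is_derive_sqnorm.
have := is_deriveM dS (dH y0).
by rewrite /GRing.scale/= addrC; congr (is_derive _ _ _ (_ + _)); ring.
Qed.

End cut_functions.

Section integration_on_rows.
Context {R : realType} {n : nat}.
Local Notation mR := (measurableTypeR R).
Local Notation mu := (@lebesgue_tuple R n.+1).

Lemma continuous_compact_support_bounded (D : 'rV[R]_n.+1 -> R) (B : R) :
  continuous D -> (forall (y : 'rV[R]_n.+1) j, B < `|y 0 j| -> D y = 0) ->
  exists C, forall y, `|D y| <= C.
Proof.
move=> cD D0.
have cbox : compact [set v : 'rV[R]_n.+1 | forall j, `[- B, B]%classic (v ord0 j)].
  by apply: (@rV_compact _ _ (fun=> `[- B, B]%classic)) => _; exact: segment_compact.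
have /compact_bounded[M [_ MP]] := continuous_compact (continuous_subspaceT cD) cbox.
exists (`|M| + 1) => y.
have [[j /D0 ->]|h] := pselect (exists j, B < `|y 0 j|).
  by rewrite normr0 addr_ge0.
have M1 : M < `|M| + 1 by rewrite (le_lt_trans (ler_norm _))// ltrDl.
apply: (MP _ M1 (D y)); exists y => // j /=; rewrite in_itv/= -ler_norml leNgt; apply/negP => Bj.
by apply: h; exists j.
Qed.

Lemma measurable_row_of_tuple_coord i :
  measurable_fun setT (fun t : n.+1.-tuple mR => row_of_tuple t 0 i).
Proof.
under eq_fun do rewrite mxE; exact: measurable_tnth.
Qed.

Lemma measurable_continuous_row (D : 'rV[R]_n.+1 -> R) :
  continuous D -> measurable_fun setT (fun t : n.+1.-tuple mR => D (row_of_tuple t)).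
Proof.
move=> cD.
exact: (measurable_fun_continuous_comp measurable_row_of_tuple_coord (@openT _)
  (fun y _ => cD y) (fun=> Logic.I)).
Qed.

Lemma row_of_set_coord (t : n.+1.-tuple mR) i (s : R) :
  row_of_tuple (set_coord i t s) = row_of_tuple (set_coord i t 0) + s *: delta_mx 0 i.
Proof.
apply/rowP => j; rewrite !mxE !tnth_mktuple eqxx/=.
by have [_|_] := eqVneq j i; rewrite ?mulr1 ?add0r// mulr0 addr0.
Qed.

Lemma integral_partial_row (W D : 'rV[R]_n.+1 -> R) (B : R) i :
  continuous D -> (forall y, is_derive y (delta_mx 0 i) W (D y)) ->
  (forall (y : 'rV[R]_n.+1) j, B < `|y 0 j| -> D y = 0 /\ W y = 0) ->
  mu.-integrable setT (fun t => (D (row_of_tuple t))%:E) /\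
  (\int[mu]_t (D (row_of_tuple t))%:E = 0)%E.
Proof.
move=> cD dW supp.
have [C DC] := continuous_compact_support_bounded cD (fun y j h => (supp y j h).1).
have supp' (t : n.+1.-tuple mR) j : B < `|tnth t j : R| ->
    D (row_of_tuple t) = 0 /\ W (row_of_tuple t) = 0.
  by move=> h; apply: (supp _ j); rewrite mxE.
split.
  apply: (@lebesgue_tuple_integrable _ _ (fun t => D (row_of_tuple t)) B C).
  - exact: measurable_continuous_row.
  - by move=> t; exact: DC.
  - by move=> t j /supp'[].
apply: (@integral_partial_compact _ _ i (fun t => W (row_of_tuple t))
  (fun t => D (row_of_tuple t)) B C).
- exact: measurable_continuous_row.
- by move=> t; exact: DC.
- exact: supp'.
- move=> t s; rewrite row_of_set_coord; under eq_fun do rewrite row_of_set_coord.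
  by apply: (is_derive_line W _ _ s _).1.
- move=> t; under eq_fun do rewrite row_of_set_coord.
  move=> s; apply: (@continuous_comp _ _ _
    (fun s : R => row_of_tuple (set_coord i t 0) + s *: delta_mx 0 i) D); last exact: cD.
  by apply: cvgD; [exact: cvg_cst|apply: cvgZl; exact: cvg_id].
Qed.

End integration_on_rows.

Section orthogonality.
Context {R : realType} {n : nat}.
Variables (f g : sphere R n -> R) (lam nu : R).
Hypotheses (Cf : sphere_C2 f) (Cg : sphere_C2 g).
Hypothesis ef : forall x, laplace_beltrami f x = - lam * f x.
Hypothesis eg : forall x, laplace_beltrami g x = - nu * g x.
Hypothesis lam_nu : lam != nu.
Local Notation mR := (measurableTypeR R).
Local Notation mu := (@lebesgue_tuple R n.+1).
Local Notation F := (homog0 f).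
Local Notation G := (homog0 g).

(** The factor [s] cancels the [|y|^-2] of the Laplacian, so that exactly the cutoff remains. *)
Let psi k s := s * cutoff k s : R.

(* By Euler's identity the divergence of [psi (|y|^2) (F grad G - G grad F)] has
   no contribution from the gradient of the radial factor. *)
Lemma integral_cutoff_homog0 k :
  (\int[mu]_t (cutoff k (sqnorm (row_of_tuple t)) *
    (F (row_of_tuple t) * G (row_of_tuple t)))%:E = 0)%E.
Proof.
have a0 : 0 < k.+1%:R^-1 :> R by rewrite invr_gt0.
have [psi' dpsi cpsi'] : C1 (psi k) by apply: C1M; [exact: C1_id|exact: C1_cutoff].
have psi_l s : s < k.+1%:R^-1 -> psi k s = 0.
  by move=> /ltW sk; rewrite /psi cutoff_left// mulr0.
have psi_r s : 2 < s -> psi k s = 0.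
  by move=> /ltW sk; rewrite /psi cutoff_right// mulr0.
have psi'_l s : s < k.+1%:R^-1 -> psi' s = 0.
  move=> sk; have d0 : is_derive (s : R) 1 (psi k) 0.
    apply: (@near_eq_is_derive R R R (cst 0)).
    by apply: filterS (lt_nbhsl sk) => t /psi_l ->.
  by rewrite -(@derive_val _ _ _ _ _ _ _ (dpsi s)) (@derive_val _ _ _ _ _ _ _ d0).
have psi'_r s : 2 < s -> psi' s = 0.
  move=> sk; have d0 : is_derive (s : R) 1 (psi k) 0.
    apply: (@near_eq_is_derive R R R (cst 0)).
    by apply: filterS (lt_nbhsr sk) => t /psi_r ->.
  by rewrite -(@derive_val _ _ _ _ _ _ _ (dpsi s)) (@derive_val _ _ _ _ _ _ _ d0).
have cpsi : continuous (psi k) by apply: C1_continuous; exists psi'.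
(* [V] is the Green field and [V'] the diagonal of its derivative, where the products of first
   derivatives cancel; [D] is the derivative of the cut field. *)
pose V i y := F y * partial i G y - G y * partial i F y.
pose V' i y := F y * partial i (partial i G) y - G y * partial i (partial i F) y.
pose D i y := psi' (sqnorm y) * (2 * y 0 i * V i y) + psi k (sqnorm y) * V' i y.
have dV i y : y != 0 -> is_derive y (delta_mx 0 i) (V i) (V' i y).
  move=> y0; have [_ /(_ i)[dF _ /(_ i)[dF2 _]]] := Cf y0.
  have [_ /(_ i)[dG _ /(_ i)[dG2 _]]] := Cg y0.
  have h := is_deriveB (is_deriveM (derivableP dF) (derivableP dG2))
     (is_deriveM (derivableP dG) (derivableP dF2)).
  apply: (is_derive_eq h).
  have ringE (p q r s t w : R) : p * q + r * s - (t * w + s * r) = p * q - t * w by ring.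
  exact: ringE.
have cV i y : y != 0 -> {for y, continuous (V i)}.
  move=> y0; have [cF /(_ i)[_ cF1 _]] := Cf y0.
  have [cG /(_ i)[_ cG1 _]] := Cg y0.
  exact: (cvgB (cvgM cF cG1) (cvgM cG cF1)).
have cV' i y : y != 0 -> {for y, continuous (V' i)}.
  move=> y0; have [cF /(_ i)[_ _ /(_ i)[_ cF2]]] := Cf y0.
  have [cG /(_ i)[_ _ /(_ i)[_ cG2]]] := Cg y0.
  exact: (cvgB (cvgM cF cG2) (cvgM cG cF2)).
have cD i : continuous (D i).
  have c1 : continuous (fun y => psi' (sqnorm y) * (2 * y 0 i * V i y)).
    apply: (@continuous_cut _ _ psi' _ a0 psi'_l (fun y => 2 * y 0 i * V i y) cpsi').
    move=> y y0; have cc := @coord_continuous R 1 n.+1 0 i y.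
    exact: (cvgM (cvgM (cvg_cst _) cc) (cV i y y0)).
  have c2 := @continuous_cut _ _ (psi k) _ a0 psi_l (V' i) cpsi (cV' i).
  by move=> y; exact: (cvgD (c1 y) (c2 y)).
have int0 i := @integral_partial_row _ _ (fun y => psi k (sqnorm y) * V i y) (D i) 2 i
  (cD i) (fun y => is_derive_cut a0 psi_l dpsi psi'_l (dV i y)).
have supp i (y : 'rV[R]_n.+1) j : 2 < `|y 0 j| ->
    D i y = 0 /\ psi k (sqnorm y) * V i y = 0.
  move=> yj; have y2 : 2 < sqnorm y.
    apply: lt_le_trans (coord_sqr_le y j); rewrite -real_normK ?num_real//.
    by rewrite expr2; nra.
  by rewrite /D psi'_r// psi_r// !mul0r addr0.
(* The divergence: Euler's identity removes the terms with [psi'], and the eigenvalue equations turn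
   the rest into a multiple of the cut product. *)
have sumD y : \sum_i D i y = (lam - nu) * (cutoff k (sqnorm y) * (F y * G y)).
  have [->|y0] := eqVneq y 0.
    rewrite sqnorm0 cutoff_left ?ltW// mul0r mulr0 big1// => i _.
    by rewrite /D sqnorm0 psi'_l// psi_l// !mul0r addr0.
  rewrite /D big_split/= -!mulr_sumr.
  have -> : \sum_i 2 * y 0 i * V i y = 0.
    rewrite (eq_bigr (fun i => 2 * F y * (y 0 i * partial i G y) -
      2 * G y * (y 0 i * partial i F y))); last by move=> i _; rewrite /V; ring.
    by rewrite sumrB -!mulr_sumr !sum_partial_homog0// !mulr0 subr0.
  have -> : \sum_i V' i y = F y * (- nu * (sqnorm y)^-1 * G y) -
      G y * (- lam * (sqnorm y)^-1 * F y).
    have lF := laplacian_eigen Cf ef y0; have lG := laplacian_eigen Cg eg y0.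
    by rewrite -lF -lG sumrB !mulr_sumr.
  rewrite mulr0 add0r /psi.
  have s0 : sqnorm y != 0 by rewrite sqnorm_eq0.
  by field.
have sum0 : (\int[mu]_t (\sum_i D i (row_of_tuple t))%:E = 0)%E.
  under eq_integral do rewrite -sumEFin.
  rewrite integral_sum//; last by move=> i; have [] := int0 i (supp i).
  by rewrite big1// => i _; have [] := int0 i (supp i).
have ln0 : lam - nu != 0 by rewrite subr_eq0.
have intD : mu.-integrable setT (fun t => (\sum_i D i (row_of_tuple t))%:E).
  under eq_fun do rewrite -sumEFin.
  by apply: integrable_sum => // i _; have [] := int0 i (supp i).
(* As the eigenvalues differ, the factor [lam - nu] can be divided out. *)
transitivity (\int[mu]_t (((lam - nu)^-1)%:E * (\sum_i D i (row_of_tuple t))%:E))%E.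
  apply: eq_integral => t _; rewrite sumD -EFinM; congr (_%:E).
  by rewrite mulKf.
by rewrite integralZl// sum0 mule0.
Qed.

Lemma bounded_eigenfunctions : exists2 C, 0 <= C & forall y, `|F y * G y| <= C.
Proof.
have [B1 fB] := sphere_continuous_bounded (fun y y0 => (Cf y0).1).
have [B2 gB] := sphere_continuous_bounded (fun y y0 => (Cg y0).1).
exists (B1 * B2).
  by rewrite mulr_ge0// (le_trans _ (fB point), le_trans _ (gB point)).
by move=> y; rewrite normrM ler_pM// /homog0; [exact: fB|exact: gB].
Qed.

Lemma eigenfunctions_orthogonal :
  \int[surface_measure n]_x (f x * g x) = 0.
Proof.
have mf := sphere_continuous_measurable (fun y y0 => (Cf y0).1).
have mg := sphere_continuous_measurable (fun y y0 => (Cg y0).1).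
have [C C0 FGC] := bounded_eigenfunctions.
rewrite /Rintegral (@surface_integral _ _ (fun x => f x * g x) C); last 2 first.
- exact: measurable_funM.
- by move=> x; have := FGC (x : 'rV[R]_n.+1); rewrite /homog0 radial_sphere.
suff -> : (\int[mu]_(t in @punctured_ball R n)
    (f (radial (row_of_tuple t)) * g (radial (row_of_tuple t)))%:E = 0)%E.
  by rewrite mule0.
pose FG (t : n.+1.-tuple mR) := F (row_of_tuple t) * G (row_of_tuple t).
have mFG : measurable_fun setT FG.
  by apply: measurable_funM;
    [exact: (measurableT_comp mf (@measurable_radial R n))
    |exact: (measurableT_comp mg (@measurable_radial R n))].
have msq : measurable_fun setT (fun t : n.+1.-tuple mR => sqnorm (row_of_tuple t)).
  by apply: measurable_continuous_row; exact: continuous_sqnorm.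
(* Every cutoff vanishes once the squared norm reaches 2, so this box of finite measure contains all
   the supports. *)
have [D [mD Doo DP]] := lebesgue_tuple_box (2 : R) n.+1.
pose fk k (t : n.+1.-tuple mR) := (cutoff k (sqnorm (row_of_tuple t)) * FG t)%:E.
have mfk k : measurable_fun setT (fk k).
  apply/measurable_EFinP; apply: measurable_funM => //.
  apply: (measurableT_comp _ msq); apply: continuous_measurable_fun.
  by apply: C1_continuous; exact: C1_cutoff.
pose finf (t : n.+1.-tuple mR) := ((0 < sqnorm (row_of_tuple t) <= 1)%R%:R * FG t)%:E.
have cvgf t : fk ^~ t @ \oo --> finf t.
  apply: cvg_EFin; first exact: nearW.
  by apply: cvgMl; exact: cutoff_cvg.
have mfinf : measurable_fun setT finf.
  apply/measurable_EFinP; apply: (@measurable_fun_cvg _ _ _ _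
    (fun k t => cutoff k (sqnorm (row_of_tuple t)) * FG t)).
    by move=> k; apply/measurable_EFinP; exact: (mfk k).
  by move=> t _; apply: cvgMl; exact: cutoff_cvg.
(* The integrable majorant is the bound [C] on the box, independent of [k]. *)
have [|||_ _ dc] := @dominated_convergence _ _ _ mu setT measurableT fk finf
  ((EFin \o cst C) \_ D) mfk mfinf _ _ _.
- by apply: aeW => t _; exact: cvgf.
- apply/(integrable_mkcond _ mD).
  apply: measurable_bounded_integrable => //.
  by exists C; split; [exact: num_real|move=> M CM t _ /=; rewrite ger0_norm// ltW].
- apply: aeW => t k _; rewrite patchE; case: ifPn => tD.
    rewrite lee_fin normrM ger0_norm ?cutoff_ge0// -[leRHS]mul1r.
    by rewrite ler_pM ?cutoff_ge0 ?cutoff_le1//; exact: FGC.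
  rewrite /fk cutoff_right ?mul0r ?abse0//.
  move: tD; rewrite notin_setE => tD; rewrite leNgt; apply/negP => s2; apply: tD.
  apply: DP => i; have := coord_sqr_le (row_of_tuple t) i.
  by rewrite mxE -real_normK ?num_real// => h; nra.
have fk0 k : (\int[mu]_t fk k t = 0)%E by exact: integral_cutoff_homog0.
have lim0 : (\int[mu]_t finf t = 0)%E.
  move: dc; rewrite [X in X @ _ --> _](_ : _ = cst 0%E); last exact/funext.
  move=> dc; exact: (cvg_unique (@ereal_hausdorff R) dc (cvg_cst 0%E)).
rewrite -[RHS]lim0 integral_mkcond; apply: eq_integral => t _.
have ballE : (t \in @punctured_ball R n) = (0 < sqnorm (row_of_tuple t) <= 1).
  by rewrite -enorm_itv; apply/idP/idP; rewrite inE.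
by rewrite patchE /finf ballE; case: ifPn => _; rewrite ?mul1r ?mul0r.
Qed.

End orthogonality.

(** * Harmonic expansions on the torus *)

Section harmonic_functions.
Context {R : realType} {n : nat}.
Implicit Types f g : sphere R n -> R[i].

Let eigen k : R := (k * (k + n - 1))%N%:R.

(** The eigenvalue is real, so the complex equation separates into real and imaginary parts. *)
Lemma harmonic_Re k f : harmonic_space k f ->
  sphere_C2 (@complex.Re R \o f) /\
  forall x, laplace_beltrami (@complex.Re R \o f) x = - eigen k * (@complex.Re R \o f) x.
Proof.
move=> [Cr _ ef]; split => // x.
have := congr1 (@complex.Re R) (ef x); rewrite /= => ->.
rewrite -(rmorph_nat (real_complex R)) -rmorphN; case: (f x) => a b /=.
by rewrite mul0r subr0.
Qed.

Lemma harmonic_Im k f : harmonic_space k f ->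
  sphere_C2 (@complex.Im R \o f) /\
  forall x, laplace_beltrami (@complex.Im R \o f) x = - eigen k * (@complex.Im R \o f) x.
Proof.
move=> [_ Ci ef]; split => // x.
have := congr1 (@complex.Im R) (ef x); rewrite /= => ->.
rewrite -(rmorph_nat (real_complex R)) -rmorphN; case: (f x) => a b /=.
by rewrite mul0r addr0.
Qed.

Lemma harmonic_bounded_measurable k f : harmonic_space k f -> bounded_measurable f.
Proof.
move=> [Cr Ci _].
have [A fA] := sphere_continuous_bounded (fun y y0 => (Cr y y0).1).
have [B fB] := sphere_continuous_bounded (fun y y0 => (Ci y y0).1).
split.
- exact: (sphere_continuous_measurable (fun y y0 => (Cr y y0).1)).
- exact: (sphere_continuous_measurable (fun y y0 => (Ci y y0).1)).
- exists (A + B) => x; apply: le_trans (normc_le_ReIm _) _.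
  by apply: lerD; [exact: fA|exact: fB].
Qed.

Lemma harmonic_orthogonal k l f g : (0 < n)%N -> k != l ->
  harmonic_space k f -> harmonic_space l g ->
  cintegral (surface_measure n) (fun x => f x * conjc (g x)) = 0.
Proof.
move=> n0 kl Hf Hg.
have [Cfr efr] := harmonic_Re Hf; have [Cfi efi] := harmonic_Im Hf.
have [Cgr egr] := harmonic_Re Hg; have [Cgi egi] := harmonic_Im Hg.
(* For [n >= 1] the eigenvalues increase strictly with the degree; for [n = 0], degrees 0 and 1
   would share the value 0. *)
have eigen_neq : eigen k != eigen l.
  rewrite /eigen eqr_nat; apply: contra kl => /eqP e; apply/eqP.
  move: e; case: n n0 => // m _; rewrite !addnS !subn1/= => e.
  by case: (ltngtP k l) => // h; move: e h; nia.
have bf := harmonic_bounded_measurable Hf; have bg := harmonic_bounded_measurable Hg.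
have [_ _ [A fA]] := bf; have [_ _ [B gB]] := bg.
have [mfr mfi _] := bf; have [mgr mgi _] := bg.
have int (a b : sphere R n -> R) : measurable_fun setT a -> measurable_fun setT b ->
    (forall x, `|a x| <= A) -> (forall x, `|b x| <= B) ->
    (surface_measure n).-integrable setT (EFin \o (fun x => a x * b x)).
  move=> ma mb aA bB; apply: (@bounded_measurable_integrable _ _ _ _ _ (A * B)).
    exact: measurable_funM.
  by move=> x; rewrite normrM ler_pM.
have frA x : `|complex.Re (f x)| <= A by apply: le_trans (ler_Re_normc _) _.
have fiA x : `|complex.Im (f x)| <= A by apply: le_trans (ler_Im_normc _) _.
have grB x : `|complex.Re (g x)| <= B by apply: le_trans (ler_Re_normc _) _.
have giB x : `|complex.Im (g x)| <= B by apply: le_trans (ler_Im_normc _) _.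
apply/eqP; rewrite eq_complex /=; apply/andP; split; apply/eqP.
- transitivity (\int[surface_measure n]_x (complex.Re (f x) * complex.Re (g x)
      + complex.Im (f x) * complex.Im (g x))).
    by apply: eq_Rintegral => x _; case: (f x) (g x) => a b [c d] /=; rewrite mulrN opprK.
  rewrite RintegralD//; [|exact: int|exact: int].
  rewrite (eigenfunctions_orthogonal Cfr Cgr efr egr eigen_neq).
  by rewrite (eigenfunctions_orthogonal Cfi Cgi efi egi eigen_neq) addr0.
- transitivity (\int[surface_measure n]_x (complex.Im (f x) * complex.Re (g x)
      - complex.Re (f x) * complex.Im (g x))).
    by apply: eq_Rintegral => x _; case: (f x) (g x) => a b [c d] /=; rewrite mulrN addrC.
  rewrite RintegralB//; [|exact: int|exact: int].
  rewrite (eigenfunctions_orthogonal Cfi Cgr efi egr eigen_neq).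
  by rewrite (eigenfunctions_orthogonal Cfr Cgi efr egi eigen_neq) subr0.
Qed.

End harmonic_functions.

(** * Enumeration of the harmonics, and orthonormality of their products *)

Section harmonic_indices.
Variable n : nat.

(** A dependent pair, since the number of harmonics varies with the degree. *)
Definition harmonic_index := {k : nat & 'I_(kappa n k)}.

Definition harmonic_indices (N : nat) : seq harmonic_index :=
  [seq Tagged (fun k => 'I_(kappa n k)) j | k <- iota 0 N.+1, j <- enum 'I_(kappa n k)].

Lemma harmonic_indices_uniq N : uniq (harmonic_indices N).
Proof.
apply: allpairs_uniq_dep; [exact: iota_uniq|by move=> k _; exact: enum_uniq|].
by move=> [k i] [l j] _ _.
Qed.

Lemma mem_harmonic_indices N (s : harmonic_index) :
  (tag s <= N)%N -> s \in harmonic_indices N.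
Proof.
case: s => k j /= kN; apply/allpairsPdep; exists k, j.
by rewrite mem_iota ltnS kN mem_enum.
Qed.

Lemma sum_harmonic_indices (V : nmodType) (F : harmonic_index -> V) N :
  \sum_(s <- harmonic_indices N) F s =
  \sum_(k < N.+1) \sum_(j < kappa n k) F (Tagged (fun k => 'I_(kappa n k)) j).
Proof.
rewrite big_allpairs_dep -[iota 0 N.+1]/(index_iota 0 N.+1) big_mkord.
by apply: eq_bigr => k _; rewrite big_enum.
Qed.

End harmonic_indices.

Section torus_expansion.
Context {R : realType} (d1 d2 : nat) (d1_gt0 : (0 < d1)%N) (d2_gt0 : (0 < d2)%N).
Variable Y : forall n k, 'I_(kappa n k) -> sphere R n -> R[i].
Hypothesis Y_d1 : forall k, harmonic_orthonormal_basis (Y (n := d1) (k := k)).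
Hypothesis Y_d2 : forall k, harmonic_orthonormal_basis (Y (n := d2) (k := k)).

Definition harmonic n (s : harmonic_index n) : sphere R n -> R[i] := Y (tagged s).

Lemma harmonic_bm n (s : harmonic_index n) :
  (forall k, harmonic_orthonormal_basis (Y (n := n) (k := k))) ->
  bounded_measurable (harmonic s).
Proof.
by move=> Yn; have [H _ _] := Yn (tag s); exact: (harmonic_bounded_measurable (H _)).
Qed.

(** Within one degree this is part of the choice of basis; between degrees it is the orthogonality
    of eigenspaces. *)
Lemma harmonic_orthonormal n (s t : harmonic_index n) : (0 < n)%N ->
  (forall k, harmonic_orthonormal_basis (Y (n := n) (k := k))) ->
  cintegral (surface_measure n) (fun x => harmonic s x * conjc (harmonic t x))
    = (s == t)%:R.
Proof.
move=> n0 Yn; case: s t => k i [l j]; rewrite /harmonic/=.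
have [kl|kl] := eqVneq k l.
  subst l; have [_ -> _] := Yn k.
  by congr (nat_of_bool _)%:R; apply/esym/eq_Tagged.
have [Hk _ _] := Yn k; have [Hl _ _] := Yn l.
rewrite (harmonic_orthogonal n0 kl (Hk i) (Hl j)).
by rewrite (_ : _ == _ = false)//; apply: contraNF kl => /eqP e; apply/eqP; exact: (congr1 tag e).
Qed.

Definition torus_index := (harmonic_index d1 * harmonic_index d2)%type.

Definition torus_indices N : seq torus_index :=
  [seq (s, t) | s <- harmonic_indices d1 N, t <- harmonic_indices d2 N].

Definition torus_harmonic (i : torus_index) (x : torus R d1 d2) : R[i] :=
  harmonic i.1 x.1 * harmonic i.2 x.2.

Lemma torus_indices_uniq N : uniq (torus_indices N).
Proof.
apply: allpairs_uniq; [exact: harmonic_indices_uniq|exact: harmonic_indices_uniq|].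
by move=> [a b] [c e] _ _.
Qed.

Lemma torus_indices_cover i : exists N, forall n, (N <= n)%N -> i \in torus_indices n.
Proof.
exists (maxn (tag i.1) (tag i.2)) => n; rewrite geq_max => /andP[h1 h2].
by apply/allpairsP; exists i; rewrite !mem_harmonic_indices//; case: i {h1 h2}.
Qed.

Lemma sum_torus_indices (V : nmodType) (F : torus_index -> V) N :
  \sum_(i <- torus_indices N) F i =
  \sum_(k1 < N.+1) \sum_(k2 < N.+1) \sum_(j < kappa d1 k1) \sum_(j' < kappa d2 k2)
    F (Tagged (fun k => 'I_(kappa d1 k)) j, Tagged (fun k => 'I_(kappa d2 k)) j').
Proof.
rewrite big_allpairs sum_harmonic_indices; apply: eq_bigr => k1 _.
under eq_bigr do rewrite sum_harmonic_indices.
exact: exchange_big.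
Qed.

Lemma torus_harmonic_bm i : bounded_measurable (torus_harmonic i).
Proof.
apply: bounded_measurableM.
  apply: (bounded_measurable_comp (h := fst)); first exact: measurable_fst.
  exact: harmonic_bm.
apply: (bounded_measurable_comp (h := snd)); first exact: measurable_snd.
exact: harmonic_bm.
Qed.

Lemma torus_harmonic_orthonormal i j :
  cintegral (torus_measure d1 d2)
    (fun x => torus_harmonic i x * conjc (torus_harmonic j x)) = (i == j)%:R.
Proof.
have bm n (s t : harmonic_index n) :
    (forall k, harmonic_orthonormal_basis (Y (n := n) (k := k))) ->
    bounded_measurable (fun x => harmonic s x * conjc (harmonic t x)).
  move=> Yn; apply: bounded_measurableM; first exact: harmonic_bm.
  by apply: bounded_measurable_conj; exact: harmonic_bm.
(* Regrouping by sphere makes the integrand a product of functions of one factor each, ready for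
   Fubini. *)
transitivity (cintegral (surface_measure d1 \x surface_measure d2)%E
  (fun x => (harmonic i.1 x.1 * conjc (harmonic j.1 x.1)) *
            (harmonic i.2 x.2 * conjc (harmonic j.2 x.2)))).
  congr cintegral; apply/funext => x.
  by rewrite /torus_harmonic rmorphM/= mulrACA.
rewrite (cintegral_product _ _ (bm _ i.1 j.1 Y_d1) (bm _ i.2 j.2 Y_d2)) !harmonic_orthonormal//.
by rewrite -natrM mulnb; congr (nat_of_bool _)%:R; case: i j => a b [c e]; rewrite xpair_eqE.
Qed.

End torus_expansion.

(** * Summability, and the expansion theorem on the torus *)

Lemma esum_lty_bounded (R : realType) (T : choiceType) (a : T -> R)
    (r : nat -> seq T) (C : R) : (forall t, 0 <= a t) -> (forall n, uniq (r n)) ->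
  (forall t, exists N, forall n, (N <= n)%N -> t \in r n) ->
  (exists N, forall n, (N <= n)%N -> \sum_(t <- r n) a t <= C) ->
  (\esum_(t in [set: T]) (a t)%:E < +oo)%E.
Proof.
move=> a0 r_uniq r_cover [N NC]; apply: (@le_lt_trans _ _ C%:E); last exact: ltry.
apply: ge_ereal_sup => _ [A [finA _] <-].
have [n Nn An] : exists2 n, (N <= n)%N & A `<=` [set` r n].
  have /choice[M MP] := r_cover.
  (* Beyond the thresholds of its finitely many elements, [A] is contained in the list; beyond [N]
     the bound holds. *)
  exists (maxn N (\max_(t <- finmap.enum_fset (fset_set A)) M t)); first exact: leq_maxl.
  move=> t At /=; apply: MP; apply: leq_trans (leq_maxr _ _).
  by apply: leq_bigmax_seq => //; rewrite in_fset_set// mem_set.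
apply: (@le_trans _ _ (\sum_(t \in [set` r n]) (a t)%:E)%E).
  by apply: lee_fsum_nneg_subset => //; [apply/subsetP|move=> t _; rewrite lee_fin].
by rewrite -fsbig_seq// sumEFin lee_fin; exact: NC.
Qed.

Theorem theorem4p1 (R : realType) (p d d1 d2 : nat)
  (p_gt0 : (0 < p)%N) (d_gt0 : (0 < d)%N)
  (d1_gt0 : (0 < d1)%N) (d2_gt0 : (0 < d2)%N)
  (Y : forall n k, 'I_(kappa n k) -> sphere R n -> R[i])
  (Y_d1 : forall k, harmonic_orthonormal_basis (Y d1 k))
  (Y_d2 : forall k, harmonic_orthonormal_basis (Y d2 k))
  (K : torus R d1 d2 * 'rV[R]_d -> torus R d1 d2 * 'rV[R]_d -> 'M[R]_p)
  (Upsilon : forall k1 k2, 'I_(kappa d1 k1) -> 'I_(kappa d2 k2) ->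
    'rV[R]_d -> 'rV[R]_d -> 'M[R[i]]_p)
  (K_Xi : Xi_expansion Y K Upsilon) :
  (forall (u u' : 'rV[R]_d),
    (forall l m : 'I_p,
      (\esum_(k in [set: nat * nat])
        (\sum_(j < kappa d1 k.1) \sum_(j' < kappa d2 k.2)
          ComplexField.Normc.normc (Upsilon k.1 k.2 j j' u u' l m) ^+ 2)%:E
        < +oo)%E) /\
    (forall k1 k2 (j : 'I_(kappa d1 k1)) (j' : 'I_(kappa d2 k2)),
      let F (x x' : torus R d1 d2) : 'M[R[i]]_p :=
        (conjc (Y d1 k1 j x.1) * Y d1 k1 j x'.1 *
         (conjc (Y d2 k2 j' x.2) * Y d2 k2 j' x'.2)) *:
        map_mx (real_complex R) (K (x, u) (x', u')) in
      (forall l m, cintegrable (torus_measure d1 d2 \x torus_measure d1 d2)%E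
        (fun xx => F xx.1 xx.2 l m)) /\
      Upsilon k1 k2 j j' u u' =
        mxintegral (torus_measure d1 d2) (fun x' =>
          mxintegral (torus_measure d1 d2) (fun x => F x x')))) /\
  (positive_definite (fun a b => map_mx (real_complex R) (K a b)) <->
   forall k1 k2 (j : 'I_(kappa d1 k1)) (j' : 'I_(kappa d2 k2)),
     positive_definite (Upsilon k1 k2 j j')).
Proof.
pose T := torus R d1 d2.
pose mu := @torus_measure R d1 d2.
pose phi := @torus_harmonic R d1 d2 Y.
(* Degrees and multiplicities are merged into one index, as in the abstract expansion. *)
pose c (i : torus_index d1 d2) := Upsilon (tag i.1) (tag i.2) (tagged i.1) (tagged i.2).
have phi_bm := torus_harmonic_bm Y_d1 Y_d2.
have phi_orth := torus_harmonic_orthonormal d1_gt0 d2_gt0 Y_d1 Y_d2.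
have E_uniq := @torus_indices_uniq d1 d2.
have E_cover := @torus_indices_cover d1 d2.
(* Taking [N = N'] in the rectangular sums gives convergence along the exhaustion by squares. *)
have K_exp u u' l m : expands_to (@torus_indices d1 d2) phi (fun i => c i u u' l m)
    (fun z : T * T => real_complex R (K (z.1, u) (z.2, u') l m)).
  move=> e /(K_Xi u u')[M MP]; exists M => n Mn [x x'] /=.
  apply: ltW; have := MP n n Mn Mn x x' l m; congr (normc (_ - _) < e).
  rewrite /Xi_partial_sum /expansion_sum sum_torus_indices summxE.
  apply: eq_bigr => k1 _; rewrite summxE; apply: eq_bigr => k2 _.
  rewrite summxE; apply: eq_bigr => j _; rewrite summxE; apply: eq_bigr => j' _.
  rewrite mxE /Ymul /phi /torus_harmonic /harmonic/= rmorphM/= /c/= mulrC.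
  by congr (_ * _); rewrite mulrACA.
split; last first.
  split=> [Kpd k1 k2 j j'|cpd].
    exact: (coefficients_positive_definite E_uniq E_cover phi_bm phi_orth K_exp
      (Tagged (fun k => 'I_(kappa d1 k)) j, Tagged (fun k => 'I_(kappa d2 k)) j') Kpd).
  by apply: (expansion_positive_definite K_exp) => i; exact: cpd.
move=> u u'; split=> [l m|k1 k2 j j' F].
  have [N [C NC]] := expansion_coefficients_bounded E_uniq phi_bm phi_orth (K_exp u u' l m).
  (* The sum is over pairs of degrees, each term gathering its harmonics; squares of degrees match
     the lists on which the coefficients are bounded. *)
  apply: (@esum_lty_bounded _ _ _ (fun n => [seq (k1, k2) | k1 <- iota 0 n.+1, k2 <- iota 0 n.+1]) C).
  - by move=> k; apply: sumr_ge0 => j _; apply: sumr_ge0 => j' _; exact: sqr_ge0.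
  - by move=> n; apply: allpairs_uniq; [exact: iota_uniq|exact: iota_uniq|move=> [a b] [a' b']].
  - move=> k; exists (maxn k.1 k.2) => n; rewrite geq_max => /andP[h1 h2].
    by apply/allpairsP; exists k; rewrite !mem_iota !ltnS; case: k h1 h2.
  - exists N => n /NC; rewrite sum_torus_indices big_allpairs.
    rewrite -[iota 0 n.+1]/(index_iota 0 n.+1) big_mkord.
    by under [X in _ -> X <= _]eq_bigr do rewrite big_mkord.
pose i : torus_index d1 d2 :=
  (Tagged (fun k => 'I_(kappa d1 k)) j, Tagged (fun k => 'I_(kappa d2 k)) j').
(* The integrand of the statement, written with the product harmonic of index [i], has the form
   required by the abstract coefficient formula. *)
have FE x x' l m : F x x' l m =
    conjc (phi i x) * phi i x' * real_complex R (K (x, u) (x', u') l m).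
  rewrite /F !mxE /phi /torus_harmonic /harmonic/= rmorphM/=; congr (_ * _).
  by rewrite mulrACA.
split=> [l m|].
  apply: (@product_bounded_measurable_cintegrable _ _ _ _ _ mu mu).
  under eq_fun do rewrite FE.
  apply: bounded_measurableM.
    apply: (bounded_measurable_tensor (f := fun x => conjc (phi i x)) (g := phi i)) => //.
    exact: bounded_measurable_conj.
  exact: (expands_to_bm phi_bm (K_exp u u' l m)).
apply/matrixP => l m; rewrite !mxE.
rewrite [LHS](expansion_coefficient E_uniq E_cover phi_bm phi_orth i (K_exp u u' l m)).
rewrite /cintegral2; congr cintegral; apply/funext => x'; rewrite mxE.
by congr cintegral; apply/funext => x; rewrite FE.
Qed.
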